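(* Consider the radial weight $$h(r)=\begin{cases}0,&0\le r\le 1,\\ \tfrac12(\log r)^{3/2},& r>1,\end{cases}$$ and the weighted Fock space $\mathcal{A}_h(\mathbb{C})$. There exists a bounded radial symbol $\varphi\in L^\infty(\mathbb{C})$ such that the eigenvalue sequence $(\lambda_{\varphi,m})_{m\in\mathbb{N}_0}$ of the Toeplitz operator $T_\varphi$ is not uniformly continuous with respect to the square-root metric $\rho(m,n)=|\sqrt m-\sqrt n|$ on $\mathbb{N}_0$.
   Context: $\mathbb{N}_0=\{0,1,2,\dots\}$. Put $h(z):=h(|z|)$ for $z\in\mathbb{C}$. $L^2_h(\mathbb{C})$ is the Hilbert space of measurable functions with $\|f\|_h^2=\int_{\mathbb{C}}|f(z)|^2e^{-2h(z)}\,dz<\infty$ ($dz$ Lebesgue measure), $\mathcal{A}_h(\mathbb{C})$ is its closed subspace of entire functions, $P:L_h^2(\mathbb{C})\to\mathcal{A}_h(\mathbb{C})$ is the orthogonal projection, and $T_\varphi f=P(\varphi f)$ for $\varphi\in L^\infty(\mathbb{C})$. For a radial symbol $\varphi(z)=a(|z|)$ (a.e.), $T_\varphi$ acts on $P^m(\mathbb{C})=\mathbb{C}z^m$ as the scalar $$\lambda_{\varphi,m}=\frac{\int_0^\infty a(u)\,u^{2m+1}e^{-2h(u)}\,du}{\int_0^\infty u^{2m+1}e^{-2h(u)}\,du},\qquad m\in\mathbb{N}_0,$$ and $(\lambda_{\varphi,m})_{m\in\mathbb{N}_0}$ is called the eigenvalue sequence of $\varphi$. *)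

(* Defs.v *)
From HB Require Import structures.
From mathcomp Require Import all_boot all_order all_algebra.
From mathcomp Require Import all_classical all_reals all_analysis.
From mathcomp Require Import complex.

Set Implicit Arguments.
Unset Strict Implicit.
Unset Printing Implicit Defensive.

Import Order.TTheory GRing.Theory Num.Theory.
Import numFieldNormedType.Exports.

Local Open Scope classical_set_scope.
Local Open Scope ring_scope.

(* R[i] packed as a numFieldType: it then carries the topology of the modulus
   and is a normed space over itself, so that [derivable] on it is complex
   differentiability. *)
Definition Cfield (R : realType) : numFieldType := R[i].

(* [`|z|] is an element of R[i]; this is the same modulus as an element of R. *)
Definition cabs (R : realType) (z : R[i]) : R := Normc.normc z.

(* R[i] has no measurable structure in the library: measure theory on the
   complex plane is done on R * R, through [toC]. *)
Definition plane (R : realType) : Type :=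
  (measurableTypeR R * measurableTypeR R)%type.

Definition toC (R : realType) (p : plane R) : R[i] := Complex p.1 p.2.

Notation lebC R := (@lebesgue_measure R \x @lebesgue_measure R)%E.

(* Borel measurability; every Lebesgue measurable function has a Borel
   representative a.e., so the classes in L^2 and L^oo are the usual ones. *)
Definition Cmeasurable (R : realType) (f : R[i] -> R[i]) : Prop :=
  measurable_fun [set: (measurableTypeR R * measurableTypeR R)%type]
    (fun p => complex.Re (f (toC p)) : measurableTypeR R) /\
  measurable_fun [set: (measurableTypeR R * measurableTypeR R)%type]
    (fun p => complex.Im (f (toC p)) : measurableTypeR R).

Definition Cintegral (R : realType) (f : R[i] -> R[i]) : R[i] :=
  Complex (\int[lebC R]_(p in setT) complex.Re (f (toC p)))
          (\int[lebC R]_(p in setT) complex.Im (f (toC p))).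

Definition Linfty (R : realType) (f : R[i] -> R[i]) : Prop :=
  Cmeasurable f /\
  exists M : R, {ae lebC R, forall p, cabs (f (toC p)) <= M}.

(* In the sequel h : R -> R is a radial weight, extended to C by h(|z|). *)

Definition L2 (R : realType) (h : R -> R) (f : R[i] -> R[i]) : Prop :=
  Cmeasurable f /\
  (\int[lebC R]_(p in setT)
     (cabs (f (toC p)) ^+ 2 * expR (- (2 * h (cabs (toC p)))))%:E < +oo)%E.

Definition inner (R : realType) (h : R -> R) (f g : R[i] -> R[i]) : R[i] :=
  Cintegral (fun z =>
    f z * conjc (g z) * Complex (expR (- (2 * h (cabs z)))) 0).

Definition entire (R : realType) (f : R[i] -> R[i]) : Prop :=
  forall z : Cfield R, derivable (f : Cfield R -> Cfield R) z 1.

(* The weighted Fock space. *)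
Definition fock (R : realType) (h : R -> R) (f : R[i] -> R[i]) : Prop :=
  entire f /\ L2 h f.

(* [g = P f], P the orthogonal projection of L2 h onto fock h.  It determines
   the function g uniquely, since an entire function is determined by its
   a.e. class. *)
Definition is_fock_proj (R : realType) (h : R -> R) (f g : R[i] -> R[i]) :
    Prop :=
  [/\ L2 h f, fock h g &
      forall k, fock h k -> inner h (fun z => f z - g z) k = 0].

(* [g = T_phi f] for the Toeplitz operator T_phi on fock h. *)
Definition is_toeplitz (R : realType) (h : R -> R)
    (phi f g : R[i] -> R[i]) : Prop :=
  fock h f /\ is_fock_proj h (fun z => phi z * f z) g.

(* phi(z) = a(|z|) for almost every z. *)
Definition is_radial (R : realType) (phi : R[i] -> R[i]) (a : R -> R[i]) :
    Prop :=
  [/\ measurable_fun (`[0, +oo[ : set (measurableTypeR R))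
        (fun u => complex.Re (a u) : measurableTypeR R),
      measurable_fun (`[0, +oo[ : set (measurableTypeR R))
        (fun u => complex.Im (a u) : measurableTypeR R) &
      {ae lebC R, forall p, phi (toC p) = a (cabs (toC p))}].

Definition moment (R : realType) (h : R -> R) (b : R -> R) (m : nat) : R :=
  \int[@lebesgue_measure R]_(u in `[0, +oo[)
    (b u * u ^+ (2 * m + 1) * expR (- (2 * h u))).

(* The quotient defining lambda_{phi,m}, with a complex-valued numerator. *)
Definition eigenvalue_seq (R : realType) (h : R -> R) (a : R -> R[i])
    (m : nat) : R[i] :=
  Complex (moment h (fun u => complex.Re (a u)) m / moment h (fun=> 1) m)
          (moment h (fun u => complex.Im (a u)) m / moment h (fun=> 1) m).

Definition log_weight (R : realType) (r : R) : R :=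
  if r <= 1 then 0 else 2^-1 * (ln r) `^ (3 / 2).

Definition rho (R : realType) (m n : nat) : R :=
  `|Num.sqrt (m%:R : R) - Num.sqrt (n%:R : R)|.

Definition rho_unif_continuous (R : realType) (x : nat -> R[i]) : Prop :=
  forall e : R, 0 < e -> exists2 d : R, 0 < d &
    forall m n : nat, rho R m n < d -> cabs (x m - x n) < e.

(* Main.v *)
(* The eigenvalue lambda_m is the mean of the symbol against the probability
   measure proportional to u^(2m+1) e^(-2h(u)) du.  In the variable
   x = sqrt(log u) its density is, up to lower order factors,
   exp(K x^2 - x^3) with K = 2m+2, which peaks at x = 2K/3.  The identity
   K x^2 - x^3 = 4K^3/27 - (x - 2K/3)^2 (x + K/3) shows that the measures for
   different m live on essentially disjoint sets, so the symbol
   cos(3 pi/16 * sqrt(log |z|)) makes lambda_m close to (-1)^i when m+1 = 4i.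
   Since sqrt(m+4) - sqrt(m) -> 0, uniform continuity fails.

   That T_phi acts on z^m by lambda_m amounts to
   int psi(|z|) z^m conj(k(z)) dz = 0 for entire k whenever
   int psi(u) u^(2m+1) du = 0.  The substitution y = x t on the sectors
   |y| <= |x| and |x| <= |y| integrates over the four rotations of
   r (1 + i t)/sqrt(1 + t^2) with respect to r dr dt/(1 + t^2), |t| <= 1, and
   Goursat's bisection argument applied to k(z) z^(-m) on the annulus shows
   that the integral of z^m conj(k(z)) over a circle of radius r is a constant
   multiple of r^(2m). *)

Require Import Defs.
From mathcomp Require Import all_boot all_order all_algebra.
From mathcomp Require Import all_classical all_reals all_analysis.
From mathcomp Require Import measurable_realfun complex zify ring lra.
Set Implicit Arguments.
Unset Strict Implicit.
Unset Printing Implicit Defensive.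
Import Order.TTheory GRing.Theory Num.Theory.
Import numFieldNormedType.Exports.
Local Open Scope classical_set_scope.
Local Open Scope ring_scope.

(** [entire] means complex differentiable at every point, with no continuity of the derivative, so
    the circle means rest on Goursat's bisection and not on Green's formula. It is run on rectangles
    of the logarithmic plane, through [cexp], where the puncture at 0 has disappeared. A quarter
    turn suffices: a sum over the four rotations takes equal values on the two horizontal sides,
    whose contributions cancel. The parameter t is a slope and not an angle, so that y = x t is
    linear for fixed x; Tonelli and the scaling of one-dimensional Lebesgue measure then give polar
    coordinates, and y = atan t returns to the arcs. For the eigenvalues no asymptotic expansion is
    made. The exact maximum exp(4 j^3/27) of u^j e^(-2h(u)), used for j = K - 1 and j = K + 1,
    controls the integrals below and above a window around the peak; both come out smaller than the
    total mass by a factor of order exp(4 K/9). What is proved is (-1)^i lambda_m >= 1/4 for i >= 7,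
    enough to separate lambda_m from lambda_(m+4) by 1/2. *)

Lemma lebesgue_integral_scale (R : realType) (c : R) (f : R -> \bar R) :
  c != 0 -> measurable_fun [set: R] f ->
  (forall x, 0 <= f x)%E ->
  (\int[lebesgue_measure]_x f x =
   `|c|%:E * \int[lebesgue_measure]_x f (c * x)%R)%E.
Proof.
move=> c0 mf f0.
pose phi : measurableTypeR R -> measurableTypeR R := fun x => c * x.
have mphi : measurable_fun setT phi by exact: measurable_funM.
have k0 : 0 <= `|c| by [].
pose k : {nonneg R} := NngNum k0.
pose nu0 : {measure set (measurableTypeR R) -> \bar R} :=
  mscale k (pushforward (@lebesgue_measure R) phi).
pose nu := nu0 mphi.
(* By uniqueness of Lebesgue measure it suffices to compare on half-open intervals. For c < 0 the
   preimage of []a, b]] is closed at the other end, which forces the two cases. *)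
have muE (A : set (measurableTypeR R)) : measurable A -> lebesgue_measure A = nu A.
  apply: (@lebesgue_measure_unique R nu) => _ [[a b] _ <-] /=.
  rewrite /nu /nu0 /mscale /= /pushforward /phi.
  rewrite [LHS](lebesgue_measure_itv `]a, b]) /= lte_fin.
  move: c0; rewrite neq_lt => /orP[c0|c0].
  - have -> : (fun x : R => c * x) @^-1` `]a, b] = `[b / c, a / c[%classic.
      apply/seteqP; split=> x /=; rewrite !in_itv/= => /andP[].
        by rewrite ler_ndivrMr// ltr_ndivlMr// ![x * c]mulrC => -> ->.
      by rewrite ler_ndivrMr// ltr_ndivlMr// ![x * c]mulrC => -> ->.
    rewrite [in RHS](lebesgue_measure_itv `[b / c, a / c[) /= lte_fin.
    rewrite ltr_nM2r ?invr_lt0//; case: ifP; rewrite ?mule0// => _.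
    rewrite -!EFinB -EFinM; congr EFin; rewrite ltr0_norm//.
    by field; rewrite lt_eqF.
  - have -> : (fun x : R => c * x) @^-1` `]a, b] = `]a / c, b / c]%classic.
      apply/seteqP; split=> x /=; rewrite !in_itv/= => /andP[].
        by rewrite ltr_pdivrMr// ler_pdivlMr// ![x * c]mulrC => -> ->.
      by rewrite ltr_pdivrMr// ler_pdivlMr// ![x * c]mulrC => -> ->.
    rewrite [in RHS](lebesgue_measure_itv `]a / c, b / c]) /= lte_fin.
    rewrite ltr_pM2r ?invr_gt0//; case: ifP; rewrite ?mule0// => _.
    rewrite -!EFinB -EFinM; congr EFin; rewrite gtr0_norm//.
    by field; rewrite gt_eqF.
rewrite (eq_measure_integral nu); last by move=> A mA _; exact: muE.
rewrite ge0_integral_mscale//; congr (_ * _)%E.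
by rewrite ge0_integral_pushforward.
Qed.

(** * Integration over rays *)

Section polar.
Variable R : realType.
Notation mu := (@lebesgue_measure R).
Implicit Types (f : R * R -> \bar R).

(* cosat t = cos (atan t); [ray r t] is the point at distance r in direction
   atan t. *)
Definition cosat (t : R) : R := (Num.sqrt (1 + t ^+ 2))^-1.

Lemma cosat_gt0 t : 0 < cosat t.
Proof. by rewrite invr_gt0 sqrtr_gt0 ltr_pwDl// sqr_ge0. Qed.

Lemma cosat2 t : cosat t ^+ 2 = (1 + t ^+ 2)^-1.
Proof. by rewrite exprVn sqr_sqrtr// addr_ge0// sqr_ge0. Qed.

Lemma measurable_cosat : measurable_fun [set: R] cosat.
Proof.
apply: continuous_measurable_fun => t.
apply: cvgV; first by rewrite gt_eqF// sqrtr_gt0 ltr_pwDl// sqr_ge0.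
apply: (@continuous_comp _ _ _ (fun t : R => 1 + t ^+ 2)).
  by apply: cvgD; [exact: cvg_cst|exact: exprn_continuous].
exact: sqrt_continuous.
Qed.

Definition ray (r t : R) : R * R := (r * cosat t, r * cosat t * t).

Definition ind (b : bool) : R := if b then 1 else 0.

Lemma ind_ge0 b : 0 <= ind b. Proof. by case: b. Qed.

(** Since d(atan t) = dt / (1 + t^2), this is the polar density r dr dtheta restricted to the angles
    |theta| <= pi / 4. *)
Definition sector_weight (r t : R) : R :=
  ind (`|t| <= 1) * (ind (0 < r) * (r / (1 + t ^+ 2))).

Lemma measurable_ind d (T : measurableType d) (b : T -> bool) :
  measurable_fun setT b -> measurable_fun setT (fun x => ind (b x)).
Proof. by move=> mb; apply: measurable_fun_ifT. Qed.

Lemma abs_section_integral f (x : R) : measurable_fun [set: R * R] f ->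
  (forall p, 0 <= f p)%E ->
  (\int[mu]_y ((ind (`|y| <= `|x|)%R)%:E * f (x, y)) =
   \int[mu]_t ((ind (`|t| <= 1)%R)%:E * (`|x|%:E * f (x, x * t)%R)))%E.
Proof.
move=> mf f0; have [->|x0] := eqVneq x 0.
  (* At x = 0 the substitution y = x t degenerates: the indicator leaves only the null set y = 0,
     and on the other side the factor |x| vanishes. *)
  transitivity (0 : \bar R)%E.
    rewrite -(@integral_set1 R (fun y => f (0, y)) 0) [RHS]integral_mkcond.
    apply: eq_integral => y _; rewrite patchE normr0 normr_le0.
    case: (eqVneq y 0) => [->|y0].
      by rewrite mul1e mem_set.
    by rewrite mul0e memNset//= => /eqP; rewrite (negbTE y0).
  apply/esym/integral0_eq => t _.
  by rewrite normr0 mul0e mule0.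
rewrite (lebesgue_integral_scale x0); last 2 first.
- apply: emeasurable_funM.
    apply/measurable_EFinP/measurable_ind.
    by apply: measurable_fun_ler => //; exact: measurableT_comp.
  exact: measurableT_comp.
- by move=> y; rewrite mule_ge0// lee_fin ind_ge0.
rewrite -ge0_integralZl//; last 2 first.
- apply: emeasurable_funM.
    apply/measurable_EFinP/measurable_ind.
    apply: measurable_fun_ler => //; apply: measurableT_comp => //.
  apply: measurableT_comp => //; apply: measurable_fun_pair => //.
- by move=> y; rewrite mule_ge0// lee_fin ind_ge0.
apply: eq_integral => t _.
rewrite normrM -ler_pdivlMl ?normr_gt0// mulVf ?normr_eq0//.
by rewrite muleCA.
Qed.

(** With h 0 = 0 the splitting by sign is a pointwise identity, and x -> - x folds the negative half
    onto the positive one. *)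
Lemma lebesgue_integral_half_line (h : R -> \bar R) :
  measurable_fun [set: R] h -> (forall x, 0 <= h x)%E -> h 0 = 0%E ->
  (\int[mu]_x h x = \int[mu]_x ((ind (0 < x)%R)%:E * (h x + h (- x)%R)))%E.
Proof.
move=> mh h0 h00.
have mpos : measurable_fun [set: R] (fun x => (ind (0 < x))%:E).
  by apply/measurable_EFinP/measurable_ind; exact: measurable_fun_ltr.
have mneg : measurable_fun [set: R] (fun x => (ind (x < 0))%:E).
  by apply/measurable_EFinP/measurable_ind; exact: measurable_fun_ltr.
have mhN : measurable_fun [set: R] (fun x => h (- x)) by exact: measurableT_comp.
have i0 b : (0 <= (ind b)%:E)%E by rewrite lee_fin ind_ge0.
transitivity (\int[mu]_x ((ind (0 < x)%R)%:E * h x + (ind (x < 0)%R)%:E * h x))%E.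
  apply: eq_integral => x _.
  by case: (ltgtP x 0) => [_|_|->]; rewrite /ind ?mul0e ?mul1e ?add0e ?adde0 ?h00.
rewrite ge0_integralD//; last 4 first.
- by move=> x _; rewrite mule_ge0.
- exact: emeasurable_funM.
- by move=> x _; rewrite mule_ge0.
- exact: emeasurable_funM.
under [RHS]eq_integral do rewrite muleDr ?ge0_adde_def ?inE//.
rewrite ge0_integralD//; last 4 first.
- by move=> x _; rewrite mule_ge0.
- exact: emeasurable_funM.
- by move=> x _; rewrite mule_ge0.
- exact: emeasurable_funM.
congr (_ + _)%E.
rewrite (@lebesgue_integral_scale _ (-1)) ?oppr_eq0 ?oner_eq0//; last 2 first.
- exact: emeasurable_funM.
- by move=> x; rewrite mule_ge0.
rewrite normrN normr1 mul1e; apply: eq_integral => x _.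
by rewrite mulN1r oppr_lt0.
Qed.

Lemma measurable_ray : measurable_fun [set: R * R] (fun p => ray p.1 p.2).
Proof.
have m1 : measurable_fun [set: R * R] (fun p : R * R => p.1 * cosat p.2).
  by apply: measurable_funM => //; apply: measurableT_comp => //;
    exact: measurable_cosat.
by apply: measurable_fun_pair => //; apply: measurable_funM.
Qed.

Lemma measurable_weight :
  measurable_fun [set: R * R] (fun p => sector_weight p.1 p.2).
Proof.
apply: measurable_funM.
  apply: measurable_ind; apply: measurable_fun_ler => //.
  exact: measurableT_comp.
apply: measurable_funM.
  apply: measurable_ind; exact: measurable_fun_ltr.
apply: measurable_funM => //.
have -> : (fun x : R * R => (1 + x.2 ^+ 2)^-1) = (fun x => cosat x.2 ^+ 2).
  by apply/funext => x; rewrite cosat2.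
apply: measurable_funX; apply: measurableT_comp => //.
exact: measurable_cosat.
Qed.

Lemma sector_weight_ge0 (r t : R) : 0 <= sector_weight r t.
Proof.
rewrite /sector_weight mulr_ge0 ?ind_ge0//.
case: (ltrP 0 r) => r0; last by rewrite mul0r.
by rewrite mul1r divr_ge0 ?(ltW r0)// addr_ge0// sqr_ge0.
Qed.

(** After y = x t and Tonelli, x = r cos (atan t) for each fixed t turns |x| dx into r dr / (1 +
    t^2). Negative r is folded onto the opposite ray, whence the two values of [f]. *)
Lemma sector_integral f : measurable_fun [set: R * R] f ->
  (forall p, 0 <= f p)%E ->
  (\int[mu]_x \int[mu]_y ((ind (`|y| <= `|x|)%R)%:E * f (x, y)) =
   \int[mu]_t \int[mu]_r ((sector_weight r t)%:E *
     (f (ray r t) + f (- ray r t)%R)))%E.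
Proof.
move=> mf f0.
have i0 b : (0 <= (ind b)%:E)%E by rewrite lee_fin ind_ge0.
under eq_integral do rewrite abs_section_integral//.
pose F (p : R * R) :=
  ((ind (`|p.2| <= 1)%R)%:E * (`|p.1|%:E * f (p.1, p.1 * p.2)%R))%E.
have F0 p : (0 <= F p)%E by rewrite !mule_ge0.
have mF : measurable_fun [set: R * R] F.
  apply: emeasurable_funM.
    apply/measurable_EFinP/measurable_ind; apply: measurable_fun_ler => //.
    exact: measurableT_comp.
  apply: emeasurable_funM; first by do 2 apply: measurableT_comp => //.
  apply: measurableT_comp => //; apply: measurable_fun_pair => //.
  exact: measurable_funM.
transitivity (\int[mu]_t \int[mu]_x F (x, t))%E.
  exact: (@fubini_tonelli _ _ _ _ R mu mu F).
have mFt t : measurable_fun [set: R] (fun x => F (x, t)).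
  exact: measurableT_comp.
apply: eq_integral => t _ /=.
have n0 : cosat t != 0 by rewrite gt_eqF// cosat_gt0.
have mFn : measurable_fun [set: R] (fun x => F (cosat t * x, t)).
  by apply: (measurableT_comp (mFt t)).
rewrite (lebesgue_integral_scale n0)// -ge0_integralZl//.
rewrite lebesgue_integral_half_line; last 3 first.
- exact: emeasurable_funM.
- by move=> x; rewrite mule_ge0.
- by rewrite /F /= mulr0 normr0 mul0e !mule0.
apply: eq_integral => r _; rewrite /F /=.
rewrite /ray !mulrN !mulNr (mulrC r).
have -> : (- (cosat t * r, cosat t * r * t) =
  (- (cosat t * r), - (cosat t * r * t)))%R by [].
rewrite normrN.
case: (ltrP 0 r) => r0; last by rewrite /sector_weight ltNge r0 /ind mul0r mulr0 !mul0e.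
rewrite mul1e !muleA -!EFinM -muleDr ?ge0_adde_def ?inE//.
congr (_%:E * _)%E.
have c0 := cosat_gt0 t.
rewrite /sector_weight r0 -cosat2 (gtr0_norm c0) (gtr0_norm (mulr_gt0 c0 r0)).
rewrite /ind; ring.
Qed.

(* Multiplication by i. *)
Definition rotp (p : R * R) : R * R := (- p.2, p.1).

Lemma measurable_rotp : measurable_fun [set: R * R] rotp.
Proof. by apply: measurable_fun_pair => //; exact: measurableT_comp. Qed.

Definition rot_sum (V : nmodType) (f : R * R -> V) p : V :=
  f p + f (rotp p) + (f (- p) + f (- rotp p)).

Lemma measurableNp : measurable_fun [set: R * R] (fun p => - p).
Proof. by apply: measurable_fun_pair => /=; exact: measurableT_comp. Qed.

(** The diagonals lie in both closed sectors; each vertical section meets them in at most the two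
    points x and - x, a null set. *)
Lemma strict_section_integral f (x : R) : measurable_fun [set: R * R] f ->
  (forall p, 0 <= f p)%E ->
  (\int[mu]_y ((ind (`|x| <= `|y|)%R)%:E * f (x, y)) =
   \int[mu]_y ((ind (`|x| < `|y|)%R)%:E * f (x, y)))%E.
Proof.
move=> mf f0.
have i0 b : (0 <= (ind b)%:E)%E by rewrite lee_fin ind_ge0.
have mfx : measurable_fun [set: R] (fun y => f (x, y)) by exact: measurableT_comp.
apply: ge0_ae_eq_integral => //.
- apply: emeasurable_funM => //; apply/measurable_EFinP/measurable_ind.
  by apply: measurable_fun_ler => //; exact: measurableT_comp.
- apply: emeasurable_funM => //; apply/measurable_EFinP/measurable_ind.
  by apply: measurable_fun_ltr => //; exact: measurableT_comp.
- by move=> y _; rewrite mule_ge0.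
- by move=> y _; rewrite mule_ge0.
exists [set x; - x]; split.
- by apply: measurableU.
- apply: countable_lebesgue_measure0; apply: finite_set_countable.
  exact: finite_set2.
move=> y /= /not_implyP[_]; apply: contra_notP => /not_orP[yx yNx].
rewrite lt_neqAle (_ : `|x| == `|y| = false)//; apply/negP.
by rewrite eqr_norm2 => /orP[]/eqP E; [apply: yx|apply: yNx; rewrite E opprK].
Qed.

(** [sector_integral] covers |y| <= |x|; the complementary sector is its image under the quarter
    turn [rotp]. Each sector contributes a pair of opposite rays, four in all. *)
Lemma polar_integral f : measurable_fun [set: R * R] f ->
  (forall p, 0 <= f p)%E ->
  (\int[lebC R]_p f p =
   \int[lebC R]_p ((sector_weight p.1 p.2)%:E * rot_sum f (ray p.1 p.2)))%E.
Proof.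
move=> mf f0.
have i0 b : (0 <= (ind b)%:E)%E by rewrite lee_fin ind_ge0.
have w0 r t : (0 <= (sector_weight r t)%:E)%E.
  by rewrite lee_fin sector_weight_ge0.
have mle : measurable_fun [set: R * R]
    (fun p => (ind (`|p.2| <= `|p.1|)%R)%:E).
  apply/measurable_EFinP/measurable_ind.
  by apply: measurable_fun_ler; exact: measurableT_comp.
have mlt : measurable_fun [set: R * R]
    (fun p => (ind (`|p.1| < `|p.2|)%R)%:E).
  apply/measurable_EFinP/measurable_ind.
  by apply: measurable_fun_ltr; exact: measurableT_comp.
have mfr : measurable_fun [set: R * R] (f \o rotp).
  by apply: measurableT_comp => //; exact: measurable_rotp.
have mge : measurable_fun [set: R * R]
    (fun p => (ind (`|p.1| <= `|p.2|)%R)%:E).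
  apply/measurable_EFinP/measurable_ind.
  by apply: measurable_fun_ler; exact: measurableT_comp.
have mW (g : R * R -> \bar R) : measurable_fun [set: R * R] g ->
    measurable_fun [set: R * R] (fun p => (sector_weight p.1 p.2)%:E *
      (g (ray p.1 p.2) + g (- ray p.1 p.2)%R))%E.
  move=> mg; apply: emeasurable_funM.
    by apply: (measurableT_comp _ measurable_weight).
  apply: emeasurable_funD; apply: measurableT_comp => //.
    exact: measurable_ray.
  by apply: (measurableT_comp measurableNp); exact: measurable_ray.
have g0 (g : R * R -> \bar R) : (forall p, 0 <= g p)%E -> forall p : R * R,
    (0 <= (sector_weight p.1 p.2)%:E *
      (g (ray p.1 p.2) + g (- ray p.1 p.2)%R))%E.
  by move=> gp p; rewrite mule_ge0// adde_ge0.
transitivity (\int[lebC R]_p ((ind (`|p.2| <= `|p.1|)%R)%:E * f p) +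
    \int[lebC R]_p ((ind (`|p.1| < `|p.2|)%R)%:E * f p))%E.
  rewrite -ge0_integralD//; last 4 first.
  - by move=> p _; rewrite mule_ge0.
  - exact: emeasurable_funM.
  - by move=> p _; rewrite mule_ge0.
  - exact: emeasurable_funM.
  apply: eq_integral => p _.
  by rewrite /ind; case: ltrP; rewrite ?mul1e ?mul0e ?adde0 ?add0e.
rewrite (@fubini_tonelli1 _ _ _ _ R mu mu); last 2 first.
- exact: emeasurable_funM.
- by move=> p; rewrite mule_ge0.
rewrite /fubini_F /= sector_integral//.
rewrite (@fubini_tonelli1 _ _ _ _ R mu mu
  (fun p => (ind (`|p.1| < `|p.2|)%R)%:E * f p)%E); last 2 first.
- exact: emeasurable_funM.
- by move=> p; rewrite mule_ge0.
rewrite /fubini_F /=.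
under [X in (_ + X)%E]eq_integral do rewrite -strict_section_integral//.
(* The quarter turn in two moves: Tonelli exchanges the variables, then x -> - x in the inner
   integral. *)
rewrite (_ : (\int[mu]_x \int[mu]_y ((ind (`|x| <= `|y|)%R)%:E * f (x, y)) =
  \int[mu]_x \int[mu]_y ((ind (`|y| <= `|x|)%R)%:E * (f \o rotp) (x, y)))%E); last first.
  transitivity (\int[mu]_y \int[mu]_x ((ind (`|x| <= `|y|)%R)%:E * f (x, y)))%E.
    apply: (@fubini_tonelli _ _ _ _ R mu mu
      (fun p => (ind (`|p.1| <= `|p.2|)%R)%:E * f p)%E).
    - exact: emeasurable_funM.
    - by move=> p; rewrite mule_ge0.
  apply: eq_integral => y _.
  rewrite (@lebesgue_integral_scale _ (-1)) ?oppr_eq0 ?oner_eq0//; last 2 first.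
  - apply: emeasurable_funM; last exact: measurableT_comp.
    apply/measurable_EFinP/measurable_ind.
    by apply: measurable_fun_ler => //; exact: measurableT_comp.
  - by move=> x; rewrite mule_ge0.
  rewrite normrN normr1 mul1e; apply: eq_integral => x _.
  by rewrite mulN1r normrN.
rewrite sector_integral//.
pose Wi (g : R * R -> \bar R) (p : R * R) :=
  ((sector_weight p.1 p.2)%:E * (g (ray p.1 p.2) + g (- ray p.1 p.2)%R))%E.
transitivity (\int[lebC R]_p (Wi f p + Wi (f \o rotp) p))%E.
  rewrite [RHS]ge0_integralD//; last 4 first.
  - by move=> p _; exact: g0.
  - exact: mW.
  - by move=> p _; apply: g0 => q /=.
  - exact: mW.
  rewrite !(@fubini_tonelli2 _ _ _ _ R mu mu)//; [exact: mW| |exact: mW|].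
  - by move=> p; apply: g0 => q /=.
  - by move=> p; apply: g0.
apply: eq_integral => p _.
rewrite /Wi -muleDr ?ge0_adde_def ?inE ?adde_ge0//=.
  by rewrite addeACA.
by move=> p; exact: f0.
Qed.
End polar.

(** * Goursat's theorem *)

Section goursat.
Variable R : realType.
Notation mu := (@lebesgue_measure R).

Lemma nested_intervals_point (u h : nat -> R) :
  (forall n, u n <= u n.+1) -> (forall n, u n.+1 + h n.+1 <= u n + h n) ->
  (forall n, 0 <= h n) -> exists x, forall n, u n <= x <= u n + h n.
Proof.
move=> u1 uh h0.
have um : {homo u : m n / (m <= n)%N >-> m <= n}.
  exact: homo_leq le_trans _.
have uhm n m : (n <= m)%N -> u m + h m <= u n + h n.
  move=> /subnK <-; elim: (m - n)%N => // k IH.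
  by rewrite addSn (le_trans (uh _)).
have ub m n : u n <= u m + h m.
  have [nm|/ltnW mn] := leqP n m.
    by rewrite (le_trans (um _ _ nm))// lerDl.
  by rewrite (le_trans _ (uhm _ _ mn))// lerDl.
exists (sup (range u)) => n; apply/andP; split.
  apply: ub_le_sup; last by exists n.
  by exists (u 0%N + h 0%N) => _ [k _ <-].
apply: ge_sup; first by exists (u 0%N), 0%N.
by move=> _ [k _ <-].
Qed.

Lemma continuous_integrable_itv (f : R -> R) (a b : R) : continuous f ->
  mu.-integrable `[a, b] (EFin \o f).
Proof.
move=> cf; apply: continuous_compact_integrable; first exact: segment_compact.
exact: continuous_subspaceT.
Qed.

Lemma Rintegral_continuous_split (f : R -> R) (a b c : R) : continuous f ->
  a <= b -> b <= c ->
  \int[mu]_(x in `[a, c]) f x =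
  \int[mu]_(x in `[a, b]) f x + \int[mu]_(x in `[b, c]) f x.
Proof.
move=> cf ab bc.
have := @Rintegral_itvB R f (BLeft a) (BRight c) b
  (continuous_integrable_itv _ _ cf).
rewrite !bnd_simp => /(_ ab bc).
rewrite Rintegral_itv_obnd_cbnd; last first.
  apply: integrableS (continuous_integrable_itv b c cf) => //.
  exact: subset_itv_oc_cc.
by move=> <-; rewrite addrCA subrr addr0.
Qed.

Lemma Rintegral_continuous_dist (f : R -> R) (a b k M : R) : continuous f ->
  a <= b -> (forall x, x \in `[a, b] -> `|f x - k| <= M) ->
  `|\int[mu]_(x in `[a, b]) f x - k * (b - a)| <= M * (b - a).
Proof.
move=> cf ab fM.
have mab : fine (mu `[a, b]) = b - a.
  rewrite lebesgue_measure_itv/= lte_fin.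
  move: ab; rewrite le_eqVlt => /predU1P[->|->]; last by rewrite -EFinB.
  by rewrite ltxx subrr.
have cst_int c : \int[mu]_(x in `[a, b]) (cst c x) = c * (b - a).
  by rewrite Rintegral_cst// mab.
have ci (g : R -> R) := @continuous_integrable_itv g a b.
have ck c : continuous (cst c : R -> R) by move=> x; exact: cst_continuous.
rewrite -!cst_int -RintegralB//; [|exact: ci|exact: ci].
have cfk : continuous (fun x => f x - cst k x).
  by move=> x; apply: cvgB; [exact: cf|exact: ck].
apply: (le_trans (le_normr_Rintegral _ _)) => //; first exact: ci.
apply: le_Rintegral => //.
- by apply: ci => x; apply: cvg_norm; exact: cfk.
- exact: ci.
Qed.

Lemma itv_dist (a w x y : R) : a <= x -> x <= a + w -> a <= y -> y <= a + w ->
  `|x - y| <= w.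
Proof. by move=> *; rewrite ler_norml; apply/andP; split; lra. Qed.

Lemma dist_twice (u v e M : R) : `|u| <= e * M -> `|v| <= e * M ->
  `|u - v| <= 2 * e * M.
Proof. by move=> uM vM; apply: (le_trans (ler_normB _ _)); lra. Qed.

Lemma four_quarters (t a b c d : R) : 4 * a < t -> 4 * b < t ->
  4 * c < t -> 4 * d < t -> ~ t <= a + b + c + d.
Proof. lra. Qed.

(* The 1-form p dx + q dy; sharing the coefficient B is its closedness. *)
Definition locally_closed_form (p q : R -> R -> R) := forall x0 y0,
  exists A B C : R, forall e, 0 < e -> exists2 d, 0 < d &
    forall x y, `|x - x0| < d -> `|y - y0| < d ->
    `|p x y - p x0 y0 - (A * (x - x0) + B * (y - y0))| <=
      e * (`|x - x0| + `|y - y0|) /\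
    `|q x y - q x0 y0 - (B * (x - x0) + C * (y - y0))| <=
      e * (`|x - x0| + `|y - y0|).

Lemma continuous_of_affine_approx (f : R -> R) (x : R) :
  (exists A, exists2 d, 0 < d & forall y, `|y - x| < d ->
    `|f y - f x - A * (y - x)| <= `|y - x|) -> {for x, continuous f}.
Proof.
move=> [A [d d0 H]]; apply/cvgrPdist_lt => e e0.
have k0 : 0 < `|A| + 1 by rewrite ltr_wpDl.
near=> y.
have yx : `|y - x| < Num.min d (e / (`|A| + 1)).
  rewrite distrC; near: y.
  by apply: (@cvgr_dist_lt _ _ _ (nbhs x)) => //; rewrite lt_min d0 divr_gt0.
move: yx; rewrite lt_min ltr_pdivlMr// => /andP[/H h1 h2].
rewrite distrC (le_lt_trans _ h2)//.
rewrite -(subrK (A * (y - x)) (f y - f x)).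
rewrite (le_trans (ler_normD _ _))// [leRHS]mulrDr mulr1 [leRHS]addrC lerD//.
by rewrite normrM mulrC.
Unshelve. all: by end_near. Qed.

Section rectangle.
Variables p q : R -> R -> R.
Hypothesis pq : locally_closed_form p q.

Lemma continuous_slice_l y : continuous (p ^~ y).
Proof.
move=> x; have [A [B [C /(_ 1 ltr01) [d d0 H]]]] := pq x y.
apply: continuous_of_affine_approx; exists A, d => // x' xx'.
have [|+ _] := H x' y xx'; first by rewrite subrr normr0.
by rewrite subrr normr0 mulr0 !addr0 mul1r.
Qed.

Lemma continuous_slice_r x : continuous (q x).
Proof.
move=> y; have [A [B [C /(_ 1 ltr01) [d d0 H]]]] := pq x y.
apply: continuous_of_affine_approx; exists C, d => // y' yy'.
have /H /(_ yy') [_ +] : `|x - x| < d by rewrite subrr normr0.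
by rewrite subrr normr0 mulr0 !add0r mul1r.
Qed.

Let V x c d := \int[mu]_(y in `[c, d]) q x y.
Let H y a b := \int[mu]_(x in `[a, b]) p x y.
(** Counterclockwise circulation of p dx + q dy around the rectangle [a, b] x [c, d]. *)
Let E a b c d := V b c d - V a c d - (H d a b - H c a b).

Let Esplit a b c d a' c' : a <= a' -> a' <= b -> c <= c' -> c' <= d ->
  E a b c d = E a a' c c' + E a a' c' d + E a' b c c' + E a' b c' d.
Proof.
move=> aa' a'b cc' c'd; rewrite /E /V /H.
have vs x := Rintegral_continuous_split (@continuous_slice_r x) cc' c'd.
have hs y := Rintegral_continuous_split (@continuous_slice_l y) aa' a'b.
rewrite !vs !hs; ring.
Qed.

Let w0_div (w : R) n : 0 <= w -> 0 <= w / 2 ^+ n.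
Proof. by move=> w0; rewrite divr_ge0// exprn_ge0. Qed.

Let divS (w : R) n : w / 2 ^+ n = w / 2 ^+ n.+1 + w / 2 ^+ n.+1.
Proof. by rewrite exprS; field. Qed.

(** Goursat's argument. Repeated quartering costs a factor 4^n in the circulation; near the limit
    point the affine part of the form has circulation zero, since dp/dy and dq/dx share the
    coefficient B, and the remainder is at most epsilon times the squared size, which is of order
    4^(-n). *)
Lemma rectangle_integral a b c d : a <= b -> c <= d ->
  \int[mu]_(y in `[c, d]) q b y - \int[mu]_(y in `[c, d]) q a y =
  \int[mu]_(x in `[a, b]) p x d - \int[mu]_(x in `[a, b]) p x c.
Proof.
move=> ab cd; apply/eqP; rewrite -subr_eq0 -/(E a b c d).
set w := b - a; set l := d - c.
have w0 : 0 <= w by rewrite subr_ge0.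
have l0 : 0 <= l by rewrite subr_ge0.
pose En n (z : R * R) := E z.1 (z.1 + w / 2 ^+ n) z.2 (z.2 + l / 2 ^+ n).
(* One of the four quarters carries at least a quarter of the circulation in absolute value. *)
have step n (z : R * R) : exists z' : R * R,
   [/\ z.1 <= z'.1 <= z.1 + w / 2 ^+ n.+1,
       z.2 <= z'.2 <= z.2 + l / 2 ^+ n.+1 &
       `|En n z| <= 4 * `|En n.+1 z'|].
  have wn := w0_div n.+1 w0; have ln := w0_div n.+1 l0.
  case: z => a1 c1 /=.
  have wE : a1 + w / 2 ^+ n = a1 + w / 2 ^+ n.+1 + w / 2 ^+ n.+1.
    by rewrite (divS w n) addrA.
  have lE : c1 + l / 2 ^+ n = c1 + l / 2 ^+ n.+1 + l / 2 ^+ n.+1.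
    by rewrite (divS l n) addrA.
  rewrite /En /= wE lE; move: wn ln.
  set w' := w / _; set l' := l / _ => wn ln.
  rewrite (@Esplit a1 _ c1 _ (a1 + w') (c1 + l')) ?lerDl//.
  set E1 := E a1 _ c1 _; set E2 := E a1 _ _ _; set E3 := E _ _ c1 _.
  set E4 := E _ _ _ _.
  have : `|E1 + E2 + E3 + E4| <= `|E1| + `|E2| + `|E3| + `|E4|.
    do 2 (apply: (le_trans (ler_normD _ _)); rewrite lerD2r).
    exact: ler_normD.
  case: (lerP `|E1 + E2 + E3 + E4| (4 * `|E1|)) => [h _|h1].
    by exists (a1, c1); split => //=; rewrite lexx ler_wpDr.
  case: (lerP `|E1 + E2 + E3 + E4| (4 * `|E2|)) => [h _|h2].
    by exists (a1, c1 + l'); split => //=; rewrite lexx ler_wpDr.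
  case: (lerP `|E1 + E2 + E3 + E4| (4 * `|E3|)) => [h _|h3].
    by exists (a1 + w', c1); split => //=; rewrite lexx ler_wpDr.
  case: (lerP `|E1 + E2 + E3 + E4| (4 * `|E4|)) => [h _|h4].
    by exists (a1 + w', c1 + l'); split => //=; rewrite lexx ler_wpDr.
  by move=> h; case: (four_quarters h1 h2 h3 h4 h).
pose next n z := sval (cid (step n z)).
have nextP n z := svalP (cid (step n z)).
pose Z := fix Z n := if n is m.+1 then next m (Z m) else (a, c).
have EZ n : `|E a b c d| <= 4 ^+ n * `|En n (Z n)|.
  elim: n => [|n IH].
    by rewrite mul1r /En /= !divr1 /w /l !(addrC _ (_ - _)) !subrK.
  apply: (le_trans IH); rewrite exprSr -mulrA ler_pM2l ?exprn_gt0//.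
  by have [] := nextP n (Z n).
have [x0 x0P] : exists x, forall n, (Z n).1 <= x <= (Z n).1 + w / 2 ^+ n.
  apply: nested_intervals_point => n; last exact: w0_div.
    by have [/andP[]] := nextP n (Z n).
  have [/andP[_ h] _ _] := nextP n (Z n).
  by rewrite (divS w n) addrA lerD2r.
have [y0 y0P] : exists y, forall n, (Z n).2 <= y <= (Z n).2 + l / 2 ^+ n.
  apply: nested_intervals_point => n; last exact: w0_div.
    by have [_ /andP[]] := nextP n (Z n).
  have [_ /andP[_ h] _] := nextP n (Z n).
  by rewrite (divS l n) addrA lerD2r.
have [A [B [C AP]]] := pq x0 y0.
rewrite -normr_le0; apply/ler_addgt0Pr => e e0; rewrite add0r.
set S := w + l.
have S0 : 0 <= S by rewrite addr_ge0.
(* The final estimate is 2 e' S^2, which this choice keeps below e; the + 1 covers the degenerate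
   case S = 0. *)
pose e' := e / (2 * S ^+ 2 + 1).
have e'0 : 0 < e' by rewrite divr_gt0// ltr_wpDl// mulr_ge0// sqr_ge0.
have [dl dl0 near_aff] := AP _ e'0.
have [n nP] : exists n, S / 2 ^+ n < dl.
  exists (Num.bound (S / dl)); rewrite ltr_pdivrMr ?exprn_gt0// mulrC.
  rewrite -ltr_pdivrMr// (lt_trans (archi_boundP _)) ?divr_ge0 ?(ltW dl0)//.
  by rewrite -natrX ltr_nat ltn_expl.
apply: (le_trans (EZ n)).
have wn := w0_div n w0; have ln := w0_div n l0.
suff Ebnd : `|En n (Z n)| <= 2 * e' * (S / 2 ^+ n) ^+ 2.
  apply: (le_trans (ler_wpM2l (exprn_ge0 n _) Ebnd)) => //.
  rewrite [leLHS](_ : _ = e' * (2 * S ^+ 2)); last first.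
    rewrite (_ : 4 = 2 ^+ 2 :> R); last by rewrite -natrX.
    rewrite -exprM mulnC exprM expr_div_n; field.
    by rewrite expf_neq0// expf_neq0.
  rewrite /e' mulrAC ler_pdivrMr ?ltr_wpDl ?mulr_ge0 ?sqr_ge0//.
  by rewrite ler_wpM2l ?(ltW e0)// lerDl.
have sE : S / 2 ^+ n = w / 2 ^+ n + l / 2 ^+ n by rewrite /S mulrDl.
move: (x0P n) (y0P n) nP wn ln; rewrite /En sE.
set a1 := (Z n).1; set c1 := (Z n).2.
set w1 := w / _; set l1 := l / _ => /andP[ax xb] /andP[cy yd] nP wn ln.
have near x y : a1 <= x <= a1 + w1 -> c1 <= y <= c1 + l1 ->
    [/\ `|x - x0| < dl, `|y - y0| < dl &
        e' * (`|x - x0| + `|y - y0|) <= e' * (w1 + l1)].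
  move=> /andP[x1 x2] /andP[y1 y2].
  have hx := itv_dist x1 x2 ax xb; have hy := itv_dist y1 y2 cy yd.
  split; last by rewrite ler_pM2l// lerD.
    by rewrite (le_lt_trans hx)// (le_lt_trans _ nP)// lerDl.
  by rewrite (le_lt_trans hy)// (le_lt_trans _ nP)// lerDr.
(* Subtracting the affine approximations at the two ends of the side cancels C and leaves B * w1;
   likewise [dp] leaves B * l1. Integrated over the other side, both become B * w1 * l1 and cancel
   in [E]. *)
have dq y : y \in `[c1, c1 + l1] ->
    `|q (a1 + w1) y - q a1 y - B * w1| <= 2 * e' * (w1 + l1).
  rewrite in_itv/= => yP.
  have [| u1 u2 u3] := near (a1 + w1) y _ yP; first by rewrite lexx lerDl wn.
  have [| v1 v2 v3] := near a1 y _ yP; first by rewrite lexx lerDl wn.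
  have [_ h1] := near_aff _ _ u1 u2; have [_ h2] := near_aff _ _ v1 v2.
  rewrite -[leLHS]/(`| _ |) [X in `|X|](_ : _ =
    (q (a1 + w1) y - q x0 y0 - (B * (a1 + w1 - x0) + C * (y - y0))) -
    (q a1 y - q x0 y0 - (B * (a1 - x0) + C * (y - y0)))); last by ring.
  exact: (dist_twice (le_trans h1 u3) (le_trans h2 v3)).
have dp x : x \in `[a1, a1 + w1] ->
    `|p x (c1 + l1) - p x c1 - B * l1| <= 2 * e' * (w1 + l1).
  rewrite in_itv/= => xP.
  have [| u1 u2 u3] := near x (c1 + l1) xP; first by rewrite lexx lerDl ln.
  have [| v1 v2 v3] := near x c1 xP; first by rewrite lexx lerDl ln.
  have [h1 _] := near_aff _ _ u1 u2; have [h2 _] := near_aff _ _ v1 v2.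
  rewrite -[leLHS]/(`| _ |) [X in `|X|](_ : _ =
    (p x (c1 + l1) - p x0 y0 - (A * (x - x0) + B * (c1 + l1 - y0))) -
    (p x c1 - p x0 y0 - (A * (x - x0) + B * (c1 - y0)))); last by ring.
  exact: (dist_twice (le_trans h1 u3) (le_trans h2 v3)).
rewrite /E /V /H.
rewrite -RintegralB//;
  [|exact/continuous_integrable_itv/continuous_slice_r..].
rewrite -RintegralB//;
  [|exact/continuous_integrable_itv/continuous_slice_l..].
have := Rintegral_continuous_dist _ _ dq; have := Rintegral_continuous_dist _ _ dp.
rewrite !lerDl !(addrC a1) !(addrC c1) !addrK => /(_ _ wn) h1 /(_ _ ln) h2.
have {}h1 := h1 _; have {}h2 := h2 _.
have /h1 : continuous (fun x : R => p x (l1 + c1) - p x c1).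
  by move=> x; apply: cvgB; exact: continuous_slice_l.
have /h2 : continuous (fun y : R => q (w1 + a1) y - q a1 y).
  by move=> y; apply: cvgB; exact: continuous_slice_r.
set Iq := \int[mu]_(x in _) _; set Ip := \int[mu]_(x in _) _ => hq hp.
rewrite (_ : Iq - Ip = (Iq - B * w1 * l1) - (Ip - B * l1 * w1)); last by ring.
apply: (le_trans (ler_normB _ _)).
rewrite (_ : 2 * e' * (w1 + l1) ^+ 2 =
  2 * e' * (w1 + l1) * l1 + 2 * e' * (w1 + l1) * w1); last by ring.
exact: lerD.
Qed.

End rectangle.
End goursat.

(** * Circle means of entire functions *)

Section complex_derivative.
Variable R : realType.
Implicit Types (z w : R[i]).

Lemma cabsE z : `|z| = (cabs z)%:C%C.
Proof. by case: z. Qed.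

Lemma cabsM z w : cabs (z * w) = cabs z * cabs w.
Proof. exact: Normc.normcM. Qed.

Lemma cabsX z n : cabs (z ^+ n) = cabs z ^+ n.
Proof.
elim: n => [|n IH]; first by rewrite !expr0; exact: Normc.normc1.
by rewrite !exprS cabsM IH.
Qed.

Lemma cabs_ge0 z : 0 <= cabs z.
Proof. by case: z => a b; rewrite /cabs /= sqrtr_ge0. Qed.

Lemma cabs_gt0 z : (0 < cabs z) = (z != 0).
Proof.
rewrite lt_neqAle cabs_ge0 andbT eq_sym; congr (~~ _).
apply/eqP/eqP => [/Normc.eq0_normc//|->]; exact: Normc.normc0.
Qed.

Lemma cabs_le_sum z : cabs z <= `|complex.Re z| + `|complex.Im z|.
Proof.
case: z => a b; rewrite /cabs /=.
rewrite -[leRHS]ger0_norm ?addr_ge0// -sqrtr_sqr ler_wsqrtr//.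
by rewrite sqrrD !real_normK ?num_real// lerD2r lerDl mulrn_wge0// mulr_ge0.
Qed.

Lemma Re_le_cabs z : `|complex.Re z| <= cabs z.
Proof.
case: z => a b; rewrite /cabs /= -sqrtr_sqr ler_wsqrtr//.
by rewrite lerDl sqr_ge0.
Qed.

Lemma Im_le_cabs z : `|complex.Im z| <= cabs z.
Proof.
case: z => a b; rewrite /cabs /= -sqrtr_sqr ler_wsqrtr//.
by rewrite lerDr sqr_ge0.
Qed.

Lemma gt0C (z : R[i]) : 0 < z -> z = (complex.Re z)%:C%C /\ 0 < complex.Re z.
Proof. by case: z => a b; rewrite ltcE /= => /andP[/eqP-> ->]. Qed.

(** Form of complex differentiability without division and with a real-valued modulus, so that real
    and imaginary parts can be bounded separately. *)
Lemma derivable_cabsP (f : Cfield R -> Cfield R) (z : Cfield R) :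
  derivable f z 1 <-> exists L : R[i], forall e : R, 0 < e ->
    exists2 d : R, 0 < d & forall w : R[i], cabs (w - z) < d ->
      cabs (f w - f z - L * (w - z)) <= e * cabs (w - z).
Proof.
split.
- move=> /cvg_ex[L /cvgrPdist_le HL]; exists L => e e0.
  have e0C : 0 < e%:C%C :> R[i] by rewrite ltcR.
  have := HL _ e0C.
  rewrite near_withinE => /nbhs_ballP[d d0 dP].
  have [dE d1] := gt0C d0; exists (complex.Re d) => // w wd.
  have [->|wz] := eqVneq w z.
    by rewrite !subrr mulr0 subr0 /cabs Normc.normc0 mulr0.
  have h0 : w - z != 0 by rewrite subr_eq0.
  have := dP (w - z); rewrite -ball_normE /= sub0r normrN cabsE dE ltcR.
  move=> /(_ wd h0).
  rewrite /GRing.scale /= mulr1 subrK cabsE lecR => H.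
  rewrite (_ : f w - f z - _ = - ((L - (w - z)^-1 * (f w - f z)) * (w - z))).
    rewrite /cabs normcN Normc.normcM ler_wpM2r//; exact: cabs_ge0.
  by field.
- move=> [L HL]; apply/cvg_ex; exists L; apply/cvgrPdist_le => e e0.
  have [eE e1] := gt0C e0; have [d d0 dP] := HL _ e1.
  rewrite near_withinE; apply/nbhs_ballP.
  exists (d%:C%C); first by rewrite /= ltcR.
  move=> h; rewrite -ball_normE /= sub0r normrN cabsE ltcR => hd h0.
  rewrite /GRing.scale /= mulr1 cabsE eE lecR.
  have := dP (h + z); rewrite addrK => /(_ hd).
  rewrite -ler_pdivrMr ?cabs_gt0// => H; apply: le_trans H.
  rewrite (_ : L - _ = - ((f (h + z) - f z - L * h) / h)).
    by rewrite /cabs normcN Normc.normcM Normc.normcV.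
  by field.
Qed.
End complex_derivative.

(** * The complex exponential and the Cauchy-Riemann equations *)

Section complex_exponential.
Variable R : realType.

Lemma is_derive_near (f : R -> R) (x l : R) : is_derive x 1 f l ->
  forall e, 0 < e -> exists2 d : R, 0 < d & forall y : R, `|y - x| < d ->
    `|f y - f x - l * (y - x)| <= e * `|y - x|.
Proof.
move=> [df <-] e e0; move: df => /cvg_ex[L /[dup] /cvg_lim HL /cvgrPdist_le/(_ _ e0)].
rewrite /derive HL//.
rewrite near_withinE => /nbhs_ballP[d d0 dP]; exists d => // y yd.
have [->|yx] := eqVneq y x; first by rewrite !subrr mulr0 subr0 normr0 mulr0.
have h0 : y - x != 0 by rewrite subr_eq0.
have := dP (y - x); rewrite -ball_normE /= sub0r normrN => /(_ yd h0).
rewrite /GRing.scale /= mulr1 subrK => H.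
rewrite (_ : f y - f x - _ = - ((L - (y - x)^-1 * (f y - f x)) * (y - x))).
  by rewrite normrN normrM ler_wpM2r.
by field.
Qed.

Definition cexp (z : R[i]) : R[i] :=
  Complex (expR (complex.Re z) * cos (complex.Im z))
          (expR (complex.Re z) * sin (complex.Im z)).

Lemma cexpD z w : cexp (z + w) = cexp z * cexp w.
Proof.
case: z w => [a b] [c d]; rewrite /cexp /= expRD cosD sinD.
by apply/eqP; rewrite eq_complex /=; apply/andP; split; apply/eqP; ring.
Qed.

(** The multiplication law [cexpD] transports this estimate at 0 to every point, which gives the
    derivative of [cexp] in [derivable_cexp]. *)
Lemma cexp_near0 (e : R) : 0 < e -> exists2 d : R, 0 < d &
  forall h : R[i], cabs h < d -> cabs (cexp h - 1 - h) <= e * cabs h.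
Proof.
(* The real part will cost 3 e1 |h| and the imaginary part 5 e1 |h|, hence 8; e1 <= 1 keeps |Re h|
   <= 1. *)
move=> e0; have [e1 [e10 e11 e1e]] :
    exists e1 : R, [/\ 0 < e1, e1 <= 1 & 8 * e1 <= e].
  exists (Num.min 1 (e / 8)); split.
  - by rewrite lt_min ltr01 divr_gt0.
  - by rewrite ge_min lexx.
  - by rewrite mulrC -ler_pdivlMr// ge_min lexx orbT.
have [d1 d10 H1] := is_derive_near (is_derive_expR (0 : R)) e10.
have [d2 d20 H2] := is_derive_near (is_derive_sin (0 : R)) e10.
have [d3 d30 H3] := is_derive_near (is_derive_cos (0 : R)) e10.
exists (Num.min (Num.min d1 d2) (Num.min d3 e1)); first by rewrite !lt_min d10 d20 d30.
move=> h; rewrite !lt_min => /andP[/andP[hd1 hd2] /andP[hd3 he1]].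
have := Re_le_cabs h; have := Im_le_cabs h; have := cabs_ge0 h.
case: h hd1 hd2 hd3 he1 => s t; set c := cabs _ => /= hd1 hd2 hd3 he1 c0 tc sc.
have := H1 s; have := H2 t; have := H3 t.
rewrite !subr0 expR0 cos0 sin0 oppr0 mul0r !mul1r !subr0 !addr0 => h3 h2 h1.
have {}h1 := h1 (le_lt_trans sc hd1).
have {}h2 := h2 (le_lt_trans tc hd2).
have {}h3 := h3 (le_lt_trans tc hd3).
have s1 : `|s| <= 1 by rewrite (le_trans sc)// ltW// (lt_le_trans he1).
have ss : `|s| <= e1 by rewrite (le_trans sc)// ltW.
have es1 : `|expR s - 1| <= 2 * `|s|.
  rewrite -(subrK s (expR s - 1)) (le_trans (ler_normD _ _))//.
  rewrite mulr2n mulrDl mul1r lerD2r (le_trans h1)// ler_piMl//.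
have es3 : expR s <= 3.
  have := ler_norm (expR s - 1); lra.
have re : `|expR s * cos t - 1 - s| <= e1 * c + 2 * (e1 * c).
  rewrite (_ : _ - s = (expR s - 1 - s) * cos t + (1 + s) * (cos t - 1)); last by ring.
  apply: (le_trans (ler_normD _ _)); rewrite !normrM lerD//.
    rewrite -[leRHS]mulr1 ler_pM// ?cos_max// (le_trans h1)//.
    by rewrite ler_wpM2l// ltW.
  rewrite ler_pM//.
    by rewrite (le_trans (ler_normD _ _))// normr1; lra.
  by rewrite (le_trans h3)// ler_wpM2l// ltW.
have im : `|expR s * sin t - t| <= 3 * (e1 * c) + 2 * e1 * c.
  rewrite (_ : _ - t = expR s * (sin t - t) + (expR s - 1) * t); last by ring.
  apply: (le_trans (ler_normD _ _)); rewrite !normrM lerD//.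
    rewrite ler_pM// ?(ger0_norm (expR_ge0 _))//.
    by rewrite (le_trans h2)// ler_wpM2l// ltW.
  by rewrite ler_pM// (le_trans es1)// ler_wpM2l.
apply: (le_trans (cabs_le_sum
  (Complex (expR s * cos t - 1 - s) (expR s * sin t - t)))) => /=.
apply: (le_trans (lerD re im)).
by rewrite [leLHS](_ : _ = (8 * e1) * c); [rewrite ler_wpM2r|ring].
Qed.

Lemma derivable_cexp (z : Cfield R) : derivable (cexp : Cfield R -> Cfield R) z 1.
Proof.
apply/derivable_cabsP; exists (cexp z) => e e0.
have N0 : 0 < cabs (cexp z) + 1 by rewrite ltr_wpDl// cabs_ge0.
have [d d0 H] := cexp_near0 (divr_gt0 e0 N0); exists d => // w wz.
rewrite (_ : cexp w - _ - _ = cexp z * (cexp (w - z) - 1 - (w - z))); last first.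
  have -> : cexp w = cexp z * cexp (w - z) by rewrite -cexpD addrC subrK.
  by ring.
rewrite cabsM (le_trans (ler_wpM2l (cabs_ge0 _) (H _ wz)))//.
rewrite mulrA ler_wpM2r ?cabs_ge0// mulrA ler_pdivrMr//.
by rewrite mulrC ler_wpM2l ?lerDl// ltW.
Qed.

(** The form is the imaginary part of g dz. With g' = a + i b the Cauchy-Riemann equations give Im g
    the coefficients (b, a) and Re g the coefficients (a, - b), so a is the shared one. *)
Lemma Re_Im_closed_form (g : R[i] -> R[i]) :
  (forall z, derivable (g : Cfield R -> Cfield R) z 1) ->
  locally_closed_form (fun x y => complex.Im (g (Complex x y)))
                      (fun x y => complex.Re (g (Complex x y))).
Proof.
move=> dg x0 y0; have /derivable_cabsP[[a b] H] := dg (Complex x0 y0).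
exists b, a, (- b) => e e0; have [d d0 dP] := H _ e0.
exists (d / 2); first by rewrite divr_gt0.
move=> x y xd yd.
have hE : Complex x y - Complex x0 y0 = Complex (x - x0) (y - y0) by [].
have nb : cabs (Complex (x - x0) (y - y0)) <= `|x - x0| + `|y - y0|.
  exact: cabs_le_sum.
have {}dP := dP (Complex x y); rewrite hE in dP.
have {}dP := dP (le_lt_trans nb _); have {}dP := dP ltac:(lra).
have {}dP := le_trans dP (ler_wpM2l (ltW e0) nb).
have {}dP : cabs (g (Complex x y) - g (Complex x0 y0) -
  Complex a b * Complex (x - x0) (y - y0)) <= e * (`|x - x0| + `|y - y0|) := dP.
move: (le_trans (Im_le_cabs _) dP) (le_trans (Re_le_cabs _) dP).
case: (g (Complex x y)) (g (Complex x0 y0)) => [u v] [u0 v0] /= hI hR.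
by split; [rewrite (addrC (b * _))|rewrite mulNr].
Qed.

End complex_exponential.

(** * Arc integrals of a function invariant under multiplication by i *)

Section circle_mean.
Variable R : realType.
Notation mu := (@lebesgue_measure R).
Notation im := (Complex 0 1 : R[i]).

Lemma cexp_neq0 (z : R[i]) : cexp z != 0.
Proof.
apply/eqP => E; have := cexpD z (- z); rewrite subrr E mul0r /cexp /=.
by rewrite expR0 cos0 sin0 mulr1 => -[] /eqP; rewrite oner_eq0.
Qed.

Variable G : R[i] -> R[i].
Hypothesis dG : forall z : Cfield R, z != 0 ->
  derivable (G : Cfield R -> Cfield R) z 1.
Hypothesis Gi : forall z, z != 0 -> G (im * z) = G z.

Let derivable_Gexp (z : Cfield R) :
  derivable ((fun z => G (cexp z)) : Cfield R -> Cfield R) z 1.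
Proof.
have /derivable1_diffP d1 := @derivable_cexp R z.
have /derivable1_diffP d2 := @dG _ (cexp_neq0 z).
apply/derivable1_diffP; exact: (differentiable_comp d1 d2).
Qed.

Lemma continuous_arc (x : R) :
  continuous (fun y : R => complex.Re (G (cexp (Complex x y)))).
Proof. exact: (continuous_slice_r (Re_Im_closed_form derivable_Gexp)). Qed.

(** Zero circulation around [x, x'] x [- pi / 4, pi / 4]: raising the imaginary part by pi / 2
    multiplies [cexp] by i, so the integrands on the horizontal sides coincide and only the two
    vertical sides remain. *)
Lemma arc_integral_const (x x' : R) :
  \int[mu]_(y in `[- (pi / 4), pi / 4]) complex.Re (G (cexp (Complex x y))) =
  \int[mu]_(y in `[- (pi / 4), pi / 4]) complex.Re (G (cexp (Complex x' y))).
Proof.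
wlog xx' : x x' / x <= x'.
  by move=> W; have [/W//|/ltW/W->] := leP x x'.
have pp : - (pi / 4) <= pi / 4 :> R.
  by rewrite -subr_ge0 opprK addr_ge0// divr_ge0// pi_ge0.
have := rectangle_integral (Re_Im_closed_form derivable_Gexp) xx' pp.
have E y : G (cexp (Complex y (pi / 4))) = G (cexp (Complex y (- (pi / 4)))).
  have -> : cexp (Complex y (pi / 4)) = im * cexp (Complex y (- (pi / 4))).
    have -> : Complex y (pi / 4) = Complex 0 (pi / 2) + Complex y (- (pi / 4)) :> R[i].
      by apply/eqP; rewrite eq_complex /= add0r eqxx /=; apply/eqP; field.
    rewrite cexpD; congr (_ * _).
    by rewrite /cexp /= expR0 cos_pihalf sin_pihalf mulr0 mulr1.
  by rewrite Gi// cexp_neq0.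
under [X in _ = X - _ -> _]eq_Rintegral do rewrite E.
by rewrite subrr => /subr0_eq ->.
Qed.

(** The substitution y = atan t produces exactly the factor 1 / (1 + t^2) of [sector_weight]. *)
Lemma arc_tan_integral (x : R) :
  \int[mu]_(t in `[-1, 1])
    (complex.Re (G (cexp (Complex x (atan t)))) * (1 + t ^+ 2)^-1) =
  \int[mu]_(y in `[- (pi / 4), pi / 4]) complex.Re (G (cexp (Complex x y))).
Proof.
rewrite /Rintegral; congr fine.
have datan : derive1 (@atan R) = (fun t => (1 + t ^+ 2)^-1).
  by apply/funext => t; exact: derive1_atan.
have catan' : continuous (fun t : R => (1 + t ^+ 2)^-1).
  exact: continuous_oneDsqrV.
have := @integration_by_substitution_increasing R atan
  (fun y => complex.Re (G (cexp (Complex x y)))) (-1) 1.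
rewrite atanN atan1 => ->//.
- by apply: eq_integral => t _; rewrite -derive1_atan.
- by move=> a b _ _; exact: lt_atan.
- by move=> t _; rewrite datan; exact: catan'.
- rewrite datan; apply/cvg_ex; exists (1 + (-1) ^+ 2)^-1.
  by apply: cvg_at_right_filter; exact: catan'.
- rewrite datan; apply/cvg_ex; exists (1 + 1 ^+ 2)^-1.
  by apply: cvg_at_left_filter; exact: catan'.
- split.
  + by move=> t _; exact: derivable_atan.
  + by apply: cvg_at_right_filter; exact: continuous_atan.
  + by apply: cvg_at_left_filter; exact: continuous_atan.
- by apply: continuous_subspaceT; exact: continuous_arc.
Qed.

End circle_mean.

Section sector_mean.
Variable R : realType.
Notation mu := (@lebesgue_measure R).
Notation im := (Complex 0 1 : R[i]).
Implicit Types (z : R[i]) (p : R * R).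

Lemma toC_rotp p : toC (rotp p) = im * toC p.
Proof.
by apply/eqP; rewrite eq_complex /=; apply/andP; split; apply/eqP; ring.
Qed.

Lemma toCN p : toC (- p) = - toC p.
Proof. by []. Qed.

Lemma toC_ray (r t : R) : 0 < r ->
  toC (ray r t) = cexp (Complex (ln r) (atan t)).
Proof.
move=> r0; rewrite /cexp /= lnK ?posrE// /toC /ray /= cos_atan.
have cosE : cos (atan t) = cosat t by exact: cos_atan.
have c0 : cosat t != 0 by rewrite gt_eqF// cosat_gt0.
congr (Complex _ _); rewrite -{2}(atanK t) /tan cosE.
by rewrite -mulrA; congr (_ * _); rewrite mulrC divfK.
Qed.

Lemma cabs_ray (r t : R) : 0 < r -> cabs (toC (ray r t)) = r.
Proof.
move=> r0; rewrite /cabs /=.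
rewrite (_ : _ + _ = (r * (1 + t ^+ 2) * (cosat t ^+ 2)) * r); last by ring.
rewrite cosat2 mulfK ?gt_eqF ?ltr_pwDl ?sqr_ge0//.
by rewrite -expr2 sqrtr_sqr gtr0_norm.
Qed.

Lemma cabsN z : cabs (- z) = cabs z.
Proof. exact: normcN. Qed.

Lemma cabs_im : cabs im = 1.
Proof. by rewrite /cabs /= expr0n expr1n /= add0r sqrtr1. Qed.

Lemma mul_conjc z : z * conjc z = (cabs z ^+ 2)%:C%C.
Proof.
case: z => a b; rewrite /cabs /= sqr_sqrtr ?addr_ge0 ?sqr_ge0//.
by apply/eqP; rewrite eq_complex /=; apply/andP; split; apply/eqP; ring.
Qed.

(** As z^m conj(z^m) = |z|^(2m), z^m conj(k) equals |z|^(2m) conj(k / z^m), and the real part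
    ignores the conjugation. This trades an integrand that is not holomorphic for one that is, up to
    a radial factor. *)
Lemma Re_expr_conjc (k z : R[i]) m : z != 0 ->
  complex.Re (z ^+ m * conjc k) = cabs z ^+ (2 * m) * complex.Re (k / z ^+ m).
Proof.
move=> z0.
have ReJ (x : R[i]) : complex.Re (conjc x) = complex.Re x by case: x.
have ReM (a : R) (x : R[i]) : complex.Re (a%:C%C * x) = a * complex.Re x.
  by case: x => u v /=; rewrite mul0r subr0.
rewrite -ReM -ReJ; congr complex.Re.
rewrite rmorphM /= conjcK rmorphXn /=.
have -> : ((cabs z ^+ (2 * m))%:C = z ^+ m * conjc z ^+ m)%C.
  by rewrite -exprMn mul_conjc exprM rmorphXn.
by field; rewrite expf_neq0.
Qed.

Definition arc_density (k : R[i] -> R[i]) m (r t : R) : R :=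
  rot_sum (fun p => complex.Re (toC p ^+ m * conjc (k (toC p)))) (ray r t) /
  (1 + t ^+ 2).

(** [G] sums k(z) / z^m over the four rotations, so [arc_integral_const] applies; C is its arc
    integral at radius 1. Integrability is recorded because radial factors are later pulled out of
    this integral. *)
Lemma sector_mean (k : R[i] -> R[i]) m : entire k -> exists C : R,
  forall r : R, 0 < r ->
  mu.-integrable `[(-1)%R, 1%R] (EFin \o arc_density k m r) /\
  (\int[mu]_(t in `[(-1)%R, 1%R]) (arc_density k m r t)%:E =
   (r ^+ (2 * m) * C)%:E)%E.
Proof.
move=> ek.
pose f z := k z / z ^+ m.
pose G z := f z + f (im * z) + (f (- z) + f (- (im * z))).
have im0 : im != 0 by rewrite -cabs_gt0 cabs_im.
have df (z : Cfield R) (c : Cfield R) : c != 0 -> z != 0 ->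
    derivable ((fun z => f (c * z)) : Cfield R -> Cfield R) z 1.
  move=> c0 z0.
  have dc : derivable (fun z : Cfield R => c * z) z 1.
    by apply: derivableM; [exact: derivable_cst|exact: derivable_id].
  have dk : derivable (fun z : Cfield R => k (c * z) : Cfield R) z 1.
    have /derivable1_diffP d1 := dc; have /derivable1_diffP d2 := ek (c * z).
    by apply/derivable1_diffP; exact: (differentiable_comp d1 d2).
  have dx : derivable ((fun z : Cfield R => c * z) ^+ m) z 1.
    exact: derivableX.
  rewrite exprfctE in dx.
  have dv : derivable (fun w : Cfield R => ((c * w) ^+ m)^-1 : Cfield R) z 1.
    apply: derivableV => //.
    by rewrite expf_neq0// mulf_neq0.
  exact: (derivableM dk dv).
have dG (z : Cfield R) : z != 0 -> derivable (G : Cfield R -> Cfield R) z 1.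
  move=> z0.
  have d1 := df z 1 (oner_neq0 _) z0.
  have d2 := df z im im0 z0.
  have mim0 : - im != 0 by rewrite oppr_eq0.
  have m10 : -1 != 0 :> R[i] by rewrite oppr_eq0 oner_eq0.
  have d3 := df z (-1) m10 z0.
  have d4 := df z (- im) mim0 z0.
  (* The same function as [G], with each term in the form f (c * w) required by [df]. *)
  pose h : R[i] -> R[i] :=
    fun w => f (1 * w) + f (im * w) + (f (-1 * w) + f (- im * w)).
  have dh : derivable (h : Cfield R -> Cfield R) z 1.
    exact: (derivableD (derivableD d1 d2) (derivableD d3 d4)).
  have Gh : G = h.
    by apply/funext => w; rewrite /G /h !mulNr !mul1r.
  rewrite Gh.
  exact: dh.
have Gi z : z != 0 -> G (im * z) = G z.
  move=> _; rewrite /G.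
  have iiz : im * (im * z) = - z.
    by case: z => a b; apply/eqP; rewrite eq_complex /=; apply/andP; split; apply/eqP; ring.
  by rewrite iiz opprK addrAC addrC addrA addrC !addrA; ring.
exists (\int[mu]_(y in `[- (pi / 4), pi / 4]) complex.Re (G (cexp (Complex 0 y)))).
move=> r r0.
pose g t := complex.Re (G (cexp (Complex (ln r) (atan t)))) / (1 + t ^+ 2).
have gi : mu.-integrable `[(-1)%R, 1%R] (EFin \o g).
  apply: continuous_integrable_itv => t; apply: cvgM.
    apply: (@continuous_comp _ _ _ atan
      (fun y => complex.Re (G (cexp (Complex (ln r) y))))).
      exact: continuous_atan.
    exact: continuous_arc.
  exact: continuous_oneDsqrV.
have ReD (x y : R[i]) : complex.Re (x + y) = complex.Re x + complex.Re y.
  by case: x y => [? ?] [? ?].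
have g0E : arc_density k m r = (fun t => r ^+ (2 * m) * g t).
  apply/funext => t; rewrite /arc_density /g mulrA; congr (_ / _).
  rewrite -toC_ray// /rot_sum !toCN toC_rotp /G.
  have z0 : toC (ray r t) != 0 by rewrite -cabs_gt0 cabs_ray.
  rewrite !Re_expr_conjc ?oppr_eq0 ?mulf_neq0//.
  rewrite !cabsN cabsM cabs_im mul1r cabs_ray// -!mulrDr; congr (_ * _).
  by rewrite !ReD.
split; first by rewrite g0E; exact: (integrableZl _ (r ^+ (2 * m)) gi).
rewrite (arc_integral_const dG Gi 0 (ln r)) -(arc_tan_integral dG).
rewrite -/g EFinM /Rintegral fineK; last exact: integrable_fin_num.
by rewrite -integralZl//; apply: eq_integral => t _; rewrite g0E EFinM.
Qed.

End sector_mean.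

(** * The radial weight and its moments *)

Section estimates.
Variable R : realType.
Notation mu := (@lebesgue_measure R).
Implicit Types (u : R) (m : nat).

(* Num.sqrt is 0 on negative numbers, so this is e^(-2h) on [0, 1] too. *)
Definition wt u : R := expR (- (Num.sqrt (ln u)) ^+ 3).

Lemma log_weightE u : expR (- (2 * log_weight u)) = wt u.
Proof.
rewrite /log_weight /wt; case: (lerP u 1) => u1.
  by rewrite (ler0_sqrtr (ln_le0 u1)) expr0n/= mulr0.
congr (expR (- _)); rewrite mulrA divff// mul1r.
rewrite -powR12_sqrt ?ln_ge0 ?ltW// -powR_mulrn ?powR_ge0// -powRrM.
by congr (_ `^ _); field.
Qed.

Lemma wt_ge0 u : 0 <= wt u. Proof. exact: expR_ge0. Qed.

Lemma measurable_wt : measurable_fun [set: R] wt.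
Proof.
apply: measurableT_comp => //; apply: measurableT_comp => //.
apply: measurable_funX.
apply: measurableT_comp; last exact: measurable_ln.
apply: continuous_measurable_fun; exact: sqrt_continuous.
Qed.

Lemma expr_wt_gt1 (j : nat) u : 1 < u -> let x := Num.sqrt (ln u) in
  u ^+ j * wt u = expR (j%:R * x ^+ 2 - x ^+ 3).
Proof.
move=> u1 x; rewrite /x sqr_sqrtr ?ln_ge0 1?ltW//.
have {1}-> : u = expR (ln u) by rewrite lnK// posrE (lt_trans ltr01).
by rewrite -expRM_natl -expRD.
Qed.

(** On u > 1 this is the factored cubic with j in place of K, and it is sharp at x = 2j/3; on [0, 1]
    the weight is 1 and u^j <= 1 suffices. *)
Lemma expr_wt_le (j : nat) u : 0 <= u ->
  u ^+ j * wt u <= expR (4 / 27 * j%:R ^+ 3).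
Proof.
move=> u0; case: (lerP u 1) => u1.
  rewrite /wt (ler0_sqrtr (ln_le0 u1)) expr0n/= oppr0 expR0 mulr1.
  apply: (le_trans (exprn_ile1 j u0 u1)).
  by rewrite -expR0 ler_expR mulr_ge0 ?exprn_ge0// divr_ge0.
rewrite expr_wt_gt1// ler_expR; set x := Num.sqrt _.
have x0 : 0 <= x by exact: sqrtr_ge0.
have j0 : 0 <= j%:R :> R by [].
rewrite -subr_ge0 (_ : _ - _ = (x - 2 * j%:R / 3) ^+ 2 * (x + j%:R / 3)); last by field.
by rewrite mulr_ge0 ?sqr_ge0// addr_ge0// divr_ge0.
Qed.

(** Doubling u raises x^2 = ln u by ln 2 < 1, and near the peak this loses at most 1 in the
    exponent. *)
Lemma expr_wt_ge (j : nat) u : let x0 := 2 * j%:R / 3 in 1 <= x0 ->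
  expR (x0 ^+ 2) <= u -> u <= 2 * expR (x0 ^+ 2) ->
  expR (4 / 27 * j%:R ^+ 3 - 1) <= u ^+ j * wt u.
Proof.
move=> x0 x01 pu up.
have e1 : 1 < expR (x0 ^+ 2).
  by rewrite -expR0 ltr_expR exprn_gt0// (lt_le_trans ltr01).
have u1 : 1 < u by exact: lt_le_trans pu.
have u0 : 0 < u by exact: lt_trans u1.
rewrite expr_wt_gt1// ler_expR; set x := Num.sqrt _.
have x0' : 0 <= x by exact: sqrtr_ge0.
have x2 : x ^+ 2 = ln u by rewrite sqr_sqrtr// ln_ge0// ltW.
have xlo : x0 ^+ 2 <= x ^+ 2 by rewrite x2 -ler_expR lnK// posrE.
have xhi : x ^+ 2 <= x0 ^+ 2 + 1.
  rewrite x2 -ler_expR lnK ?posrE// expRD (le_trans up)// mulrC.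
  rewrite ler_wpM2l ?expR_ge0//.
  by have := expR_ge1Dx (1 : R).
have jE : j%:R = 3 / 2 * x0 by rewrite /x0; field.
rewrite jE.
(* The left side is at most (x - x0)^2 (x + x0)^2 = (x^2 - x0^2)^2, because x + x0 >= 1. *)
have key : (x - x0) ^+ 2 * (x + x0 / 2) <= 1.
  have h1 : (x ^+ 2 - x0 ^+ 2) ^+ 2 <= 1.
    by rewrite exprn_ile1//; lra.
  apply: le_trans h1.
  rewrite (_ : x ^+ 2 - x0 ^+ 2 = (x - x0) * (x + x0)); last by ring.
  rewrite exprMn ler_wpM2l ?sqr_ge0//.
  by nra.
have -> : 4 / 27 * (3 / 2 * x0) ^+ 3 - 1 =
  (3 / 2 * x0 * x ^+ 2 - x ^+ 3) + ((x - x0) ^+ 2 * (x + x0 / 2) - 1) by field.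
by rewrite gerDl subr_le0.
Qed.

Lemma inv_sqr_integral (a : R) : 0 < a ->
  (\int[mu]_(x in `[a, +oo[) ((x ^- 2)%:E) = (a^-1)%:E)%E.
Proof.
move=> a0; rewrite (_ : (a^-1)%:E = 0%:E - (- a^-1)%:E)%E; last first.
  by rewrite -EFinB sub0r opprK.
have dF (x : R) : a <= x -> is_derive x 1 (fun x : R => - x^-1) (x ^- 2).
  move=> ax; have x0 : x != 0 by rewrite gt_eqF// (lt_le_trans a0).
  split; first by apply: derivableN; apply: derivableV.
  rewrite deriveN; last exact: derivableV.
  by rewrite deriveV// derive_id /GRing.scale /= mulr1 opprK.
have cinv2 (x : R) : x != 0 -> {for x, continuous (fun x : R => x ^- 2)}.
  move=> x0; apply: cvgV; first by rewrite expf_neq0.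
  exact: exprn_continuous.
apply: (@ge0_continuous_FTC2y R (fun x => x ^- 2) (fun x => - x^-1) a 0).
- by move=> x _; rewrite invr_ge0 sqr_ge0.
- apply/continuous_within_itvcyP; split.
    move=> x; rewrite in_itv/= andbT => ax.
    by apply: cinv2; rewrite gt_eqF// (lt_trans a0).
  by apply: cvg_at_right_filter; apply: cinv2; rewrite gt_eqF.
- rewrite -oppr0; apply: cvgN; apply/cvgrPdist_le => e e0.
  exists e^-1; split; first exact: num_real.
  move=> x ex; have x0 : 0 < x by rewrite (lt_trans _ ex)// invr_gt0.
  rewrite /= sub0r normrN gtr0_norm ?invr_gt0//.
  by rewrite -[e]invrK lef_pV2 ?posrE ?invr_gt0// ltW.
- by move=> x /ltW/dF d; exact: ex_derive.
- apply: cvg_at_right_filter; apply: cvgN; apply: cvgV; last exact: cvg_id.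
  by rewrite gt_eqF.
- move=> x; rewrite in_itv/= andbT => /ltW/dF d.
  by rewrite derive1E derive_val.
Qed.

Definition mom (j : nat) u : R := u ^+ j * wt u.

Lemma mom_ge0 j u : 0 <= u -> 0 <= mom j u.
Proof. by move=> u0; rewrite mulr_ge0 ?exprn_ge0 ?wt_ge0. Qed.

Lemma measurable_mom j : measurable_fun [set: R] (mom j).
Proof. by apply: measurable_funM => //; exact: measurable_wt. Qed.

Lemma measurable_momE j (D : set R) : measurable_fun D (EFin \o mom j).
Proof. by apply/measurable_funTS/measurable_EFinP; exact: measurable_mom. Qed.

Lemma mom_head j (U : R) : 0 <= U ->
  (\int[mu]_(u in `[0%R, U[) (mom j u)%:E <=
    (expR (4 / 27 * j%:R ^+ 3) * U)%:E)%E.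
Proof.
move=> U0; apply: (@le_trans _ _
    (\int[mu]_(u in `[0%R, U[) (expR (4 / 27 * j%:R ^+ 3))%:E)%E).
  apply: ge0_le_integral => //.
  - by move=> u; rewrite /= in_itv/= => /andP[u0 _]; rewrite lee_fin mom_ge0.
  - exact: measurable_momE.
  - move=> u; rewrite /= in_itv/= => /andP[u0 _].
    by rewrite lee_fin expr_wt_le.
rewrite integral_cst//.
have muU : mu (`[0, U[%classic : set R) = U%:E.
  rewrite lebesgue_measure_itv/= lte_fin.
  move: U0; rewrite le_eqVlt => /predU1P[<-|->]; first by rewrite ltxx.
  by rewrite oppr0 adde0.
by rewrite [X in (_ * X)%E]muU.
Qed.

(** Write u^j = u^(j+2) / u^2: the uniform bound for the exponent j + 2 multiplies the integral of
    u^(-2), which is 1 / V. *)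
Lemma mom_tail j (V : R) : 0 < V ->
  (\int[mu]_(u in `[V, +oo[) (mom j u)%:E <=
    (expR (4 / 27 * j.+2%:R ^+ 3) / V)%:E)%E.
Proof.
move=> V0.
have minv : measurable_fun (`[V, +oo[ : set R) (fun u : R => u ^- 2).
  apply: (@measurable_funS _ _ _ _ (`]0, +oo[ : set R)) => //.
    by move=> u; rewrite /= !in_itv/= !andbT; exact: lt_le_trans.
  apply: open_continuous_measurable_fun; first exact: interval_open.
  move=> u; rewrite inE/= in_itv/= andbT => u0; apply: cvgV.
    by rewrite expf_neq0// gt_eqF.
  exact: exprn_continuous.
have c0 : 0 <= expR (4 / 27 * j.+2%:R ^+ 3) :> R by exact: expR_ge0.
rewrite EFinM -inv_sqr_integral// -ge0_integralZl//; last 2 first.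
- exact/measurable_EFinP.
- by move=> u _; rewrite lee_fin invr_ge0 sqr_ge0.
apply: ge0_le_integral => //.
- move=> u; rewrite /= in_itv/= andbT => Vu.
  by rewrite lee_fin mom_ge0// (le_trans _ Vu)// ltW.
- exact: measurable_momE.
- by apply/measurable_EFinP; exact: measurable_funM.
- move=> u; rewrite /= in_itv/= andbT => Vu.
  have u0 : 0 < u by exact: lt_le_trans Vu.
  rewrite lee_fin ler_pdivlMr ?exprn_gt0// /mom mulrAC -exprD addn2.
  by rewrite expr_wt_le// ltW.
Qed.

Lemma integrable_mom j : mu.-integrable `[0%R, +oo[ (EFin \o mom j).
Proof.
apply/integrableP; split; first exact: measurable_momE.
apply: (@le_lt_trans _ _ (\int[mu]_(u in `[0%R, +oo[) (mom j u)%:E)%E).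
  rewrite le_eqVlt; apply/orP; left; apply/eqP; apply: eq_integral => u.
  rewrite inE/= in_itv/= andbT => u0.
  by rewrite ger0_norm ?mom_ge0.
rewrite (@itv_bndbnd_setU _ _ _ (BLeft 1)) ?bnd_simp//.
rewrite ge0_integral_setU//=; [|exact: measurable_momE| |].
- apply: lte_add_pinfty.
    exact: le_lt_trans (mom_head _ ler01) (ltry _).
  exact: le_lt_trans (mom_tail _ ltr01) (ltry _).
- move=> u; rewrite /= !in_itv/= andbT => -[/andP[u0 _]|u1];
    by rewrite lee_fin mom_ge0// (le_trans ler01).
- apply/disj_setPS => y [/=]; rewrite !in_itv/= andbT => /andP[_ y1].
  by rewrite leNgt y1.
Qed.

Lemma integrable_bounded_mom (b : R -> R) j : measurable_fun [set: R] b ->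
  (forall u, `|b u| <= 1) ->
  mu.-integrable `[0%R, +oo[ (EFin \o (fun u => b u * mom j u)).
Proof.
move=> mb b1; apply: (le_integrable _ _ _ (integrable_mom j)) => //.
- by apply/measurable_funTS/measurable_EFinP/measurable_funM => //;
    exact: measurable_mom.
- move=> u _; rewrite /= lee_fin normrM ler_piMl//.
Qed.

(** The exponent j + 1 appears because u^j du = u^(j+1) d(log u). On [p, 2p] one has u^j >= u^(j+1)
    / (2p), and the length p of the interval leaves the factor 1/2. The hypothesis is 1 <= x0 in
    [expr_wt_ge]. *)
Lemma mom_lower j : 3 / 2 <= j.+1%:R :> R ->
  ((expR (4 / 27 * j.+1%:R ^+ 3 - 1) / 2)%:E <=
    \int[mu]_(u in `[0%R, +oo[) (mom j u)%:E)%E.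
Proof.
move=> j1; pose x0 : R := 2 * j.+1%:R / 3; pose p := expR (x0 ^+ 2).
have p0 : 0 < p by exact: expR_gt0.
set c := expR (_ - 1).
have x01 : 1 <= x0 by rewrite /x0; lra.
have p2 : 0 < 2 * p by rewrite mulr_gt0.
have mup : mu (`[p, 2 * p]%classic : set R) = p%:E.
  rewrite lebesgue_measure_itv/= lte_fin ltr_pMl// ltr1n -EFinB.
  by congr EFin; ring.
have h1 : (\int[mu]_(u in `[p, (2 * p)%R]) (c / (2 * p))%:E <=
    \int[mu]_(u in `[p, (2 * p)%R]) (mom j u)%:E)%E.
  apply: ge0_le_integral => //.
  - by move=> u _; rewrite lee_fin divr_ge0 ?expR_ge0// ltW.
  - exact: measurable_momE.
  - move=> u; rewrite /= in_itv/= => /andP[pu up].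
    have u0 : 0 < u by exact: lt_le_trans pu.
    rewrite lee_fin ler_pdivrMr//.
    apply: (le_trans (expr_wt_ge x01 pu up)).
    rewrite exprS -mulrA mulrC ler_wpM2l//.
    by rewrite mom_ge0// ltW.
have h2 : (\int[mu]_(u in `[p, (2 * p)%R]) (mom j u)%:E <=
    \int[mu]_(u in `[0%R, +oo[) (mom j u)%:E)%E.
  apply: ge0_subset_integral => //.
  - exact: measurable_momE.
  - move=> u; rewrite /= in_itv/= andbT => u0.
    by rewrite lee_fin mom_ge0.
  - move=> u; rewrite /= !in_itv/= andbT => /andP[pu _].
    by rewrite (le_trans _ pu)// ltW.
apply: le_trans h2; apply: le_trans h1.
rewrite integral_cst// [X in (_ * X)%E]mup -EFinM lee_fin.
by rewrite le_eqVlt; apply/orP; left; apply/eqP; field; rewrite gt_eqF.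
Qed.

End estimates.

(** * Signed lower bound for the moments of the oscillating symbol *)

Section eigenvalues.
Variable R : realType.
Notation mu := (@lebesgue_measure R).
Implicit Types (u : R) (m : nat).

(* For q + 1 = 8 i the density [mom q] peaks at sqrt (ln u) = 16 i / 3, where
   the phase is i * pi. *)
Definition osc u : R := cos (3 * pi / 16 * Num.sqrt (ln u)).

Lemma norm_osc u : `|osc u| <= 1. Proof. exact: cos_max. Qed.

Lemma measurable_osc : measurable_fun [set: R] osc.
Proof.
apply: measurableT_comp.
  by apply: continuous_measurable_fun; exact: continuous_cos.
apply: measurable_funM => //.
apply: measurableT_comp; last exact: measurable_ln.
apply: continuous_measurable_fun; exact: sqrt_continuous.
Qed.

Lemma momentE (b : R -> R) m :
  moment (@log_weight R) b m =
  \int[mu]_(u in `[0, +oo[) (b u * mom (2 * m + 1) u).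
Proof. by apply: eq_Rintegral => u _; rewrite log_weightE mulrA. Qed.

Lemma cos_ge_half (d : R) : `|d| <= pi / 8 -> 2^-1 <= cos d.
Proof.
move=> dp; rewrite -cos_norm.
have pi0 := pi_gt0 R.
apply: (@le_trans _ _ (cos (pi / 4))); last first.
  apply: ltW; rewrite ltr_cos ?in_itv/=; first by lra.
    by rewrite normr_ge0 /=; lra.
  by apply/andP; split; lra.
have c0 : 0 < cos (pi / 4) :> R.
  by apply: cos_gt0_pihalf; apply/andP; split; lra.
have := cos2_tan2 (lt0r_neq0 c0); rewrite tan_piquarter expr1n => c2.
have : cos (pi / 4) ^+ 2 * cos (pi / 4) ^- 2 = 1 :> R.
  by rewrite mulfV// expf_neq0// gt_eqF.
by rewrite c2; set c := cos _ in c0 * => h; nra.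
Qed.

(** A deviation of 2/3 in x is a phase of (3 pi / 16) (2 / 3) = pi / 8, the range allowed by
    [cos_ge_half]; the centre contributes i pi, whose sign is (-1)^i. *)
Lemma osc_ge (i : nat) u : 1 < u ->
  `|Num.sqrt (ln u) - 2 * (8 * i)%:R / 3| <= 2 / 3 ->
  2^-1 <= (-1) ^+ i * osc u.
Proof.
move=> u1; set x := Num.sqrt _ => hx.
pose d : R := 3 * pi / 16 * (x - 2 * (8 * i)%:R / 3).
have -> : osc u = (-1) ^+ i * cos d.
  rewrite /osc -/x -(alternatingn (@cosDpi R)); congr cos.
  by rewrite /d natrM -mulr_natr; field.
rewrite mulrA -exprD -signr_odd oddD addbb expr0 !mul1r.
apply: cos_ge_half; rewrite /d normrM.
have pi0 := pi_gt0 R.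
rewrite ger0_norm; last by rewrite divr_ge0// mulr_ge0// ltW.
nra.
Qed.

(** Origin of 24: a + c <= X/12 <= M/6, while the sum is at least (M - a - c)/2 - (a + c) = M/2 - 3
    (a + c)/2 >= M/4. *)
Lemma mass_comparison (M a b c A B C X : R) : M = a + (b + c) ->
  2^-1 * b <= B -> a <= X / 24 -> c <= X / 24 -> X / 2 <= M ->
  - a <= A -> - c <= C -> 4^-1 * M <= A + (B + C).
Proof. lra. Qed.

Lemma eigen_lower (i q : nat) : (7 <= i)%N -> q.+1 = (8 * i)%N ->
  4^-1 * \int[mu]_(u in `[0, +oo[) mom q u <=
  (-1) ^+ i * \int[mu]_(u in `[0, +oo[) (osc u * mom q u).
Proof.
move=> i7 qi; pose K : R := (8 * i)%:R.
have qK : q.+1%:R = K :> R by rewrite qi.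
have qE : q%:R = K - 1 :> R by rewrite -qK -natr1 addrK.
have q2E : q.+2%:R = K + 1 :> R by rewrite -qK -natr1.
have K56 : 56 <= K.
  by rewrite /K (_ : 56 = (8 * 7)%:R) ?ler_nat ?leq_mul2l//; rewrite -natrM.
(* The cuts are the peaks for the exponents q = K - 1 and q + 2 = K + 1, those occurring in
   [mom_head] and [mom_tail]. In the variable x the window has half-width 2/3, as [osc_ge]
   requires. *)
pose U := expR ((2 * (K - 1) / 3) ^+ 2); pose V := expR ((2 * (K + 1) / 3) ^+ 2).
have U0 : 0 < U by exact: expR_gt0.
have V0 : 0 < V by exact: expR_gt0.
have UV : U <= V by rewrite ler_expR ler_sqr ?nnegrE; lra.
pose s : R := (-1) ^+ i.
have s1 : `|s| = 1 by rewrite normrX normrN1 expr1n.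
have split3 (f : R -> R) : mu.-integrable `[0, +oo[ (EFin \o f) ->
   \int[mu]_(u in `[0, +oo[) f u = \int[mu]_(u in `[0, U[) f u +
     (\int[mu]_(u in `[U, V[) f u + \int[mu]_(u in `[V, +oo[) f u).
  move=> fi.
  have sub (a b : itv_bound R) : (BLeft 0 <= a)%O ->
      mu.-integrable [set` Interval a b] (EFin \o f).
    move=> a0; apply: integrableS fi => //.
    by apply: subset_itv => //; case: b => [[] ?|[]].
  have disj (a b c : itv_bound R) : [disjoint [set` Interval a b] & [set` Interval b c]].
    apply/disj_setPS => u [/=]; rewrite !itv_boundlr => /andP[_ h1] /andP[h2 _].
    by have := le_trans h1 h2; rewrite bnd_simp ltxx.
  rewrite (@itv_bndbnd_setU _ _ _ (BLeft U)) ?bnd_simp ?(ltW U0)//.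
  rewrite Rintegral_setU//; last first.
    by rewrite -itv_bndbnd_setU ?bnd_simp ?(ltW U0).
  congr (_ + _).
  rewrite (@itv_bndbnd_setU _ _ _ (BLeft V)) ?bnd_simp//.
  rewrite Rintegral_setU// -itv_bndbnd_setU ?bnd_simp//.
  by apply: sub; rewrite bnd_simp ltW.
have im := @integrable_mom R q.
have io := integrable_bounded_mom q measurable_osc norm_osc.
have sub (f : R -> R) a b : (BLeft 0 <= a)%O ->
    mu.-integrable `[0, +oo[ (EFin \o f) ->
    mu.-integrable [set` Interval a b] (EFin \o f).
  move=> a0; apply: integrableS => //.
  by apply: subset_itv => //; case: b => [[] ?|[]].
have toR (D : set R) (f : R -> R) : measurable D ->
    mu.-integrable D (EFin \o f) ->
    (\int[mu]_(u in D) f u)%:E = (\int[mu]_(u in D) (f u)%:E)%E.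
  by move=> mD fi; rewrite fineK//; exact: integrable_fin_num.
pose X : R := expR (4 / 27 * K ^+ 3 - 1).
have X0 : 0 < X by exact: expR_gt0.
(* Multiplying the peak bounds by U, respectively dividing by V, cancels the K^2 terms and leaves -
   4 K / 9. Then X / exp y >= 1 + 4 K / 9 - 35 / 27 >= 24 once K >= 56, which is where 7 <= i comes
   from. *)
have small (y z : R) : y <= 4 / 27 * K ^+ 3 - 4 / 9 * K + 8 / 27 ->
    z <= expR y -> z <= X / 24.
  move=> yK zy; apply: (le_trans zy).
  have -> : X = expR y * expR (4 / 27 * K ^+ 3 - 1 - y).
    by rewrite -expRD; congr expR; ring.
  rewrite ler_pdivlMr// ler_wpM2l ?expR_ge0//.
  by apply: le_trans (expR_ge1Dx _); lra.
have o1 : \int[mu]_(u in `[0, U[) mom q u <= X / 24.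
  apply: (small (4 / 27 * q%:R ^+ 3 + (2 * (K - 1) / 3) ^+ 2)).
    by rewrite qE; lra.
  rewrite expRD -lee_fin toR//; last by apply: sub.
  by apply: mom_head; exact: ltW.
have o2 : \int[mu]_(u in `[V, +oo[) mom q u <= X / 24.
  apply: (small (4 / 27 * q.+2%:R ^+ 3 - (2 * (K + 1) / 3) ^+ 2)).
    by rewrite q2E; lra.
  rewrite expRD expRN -lee_fin toR//; last by apply: sub; rewrite // bnd_simp ltW.
  exact: mom_tail.
have Mlow : X / 2 <= \int[mu]_(u in `[0, +oo[) mom q u.
  rewrite -lee_fin toR// /X -qK; apply: mom_lower; rewrite qK; lra.
have outer (D : set (measurableTypeR R)) : measurable D -> D `<=` `[0, +oo[ ->
    `|\int[mu]_(u in D) (osc u * mom q u)| <= \int[mu]_(u in D) mom q u.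
  move=> mD D0.
  have iD (f : R -> R) : mu.-integrable `[0, +oo[ (EFin \o f) ->
      mu.-integrable D (EFin \o f).
    exact: integrableS.
  have h := le_normr_Rintegral mD (iD _ io).
  apply: (le_trans h).
  apply: le_Rintegral => //; [|exact: iD|].
    have := integrable_abse (iD _ io); exact.
  move=> u /D0; rewrite /= in_itv/= andbT => u0.
  by rewrite normrM (ger0_norm (mom_ge0 _ u0)) ler_piMl ?mom_ge0// norm_osc.
have i2 : mu.-integrable `[U, V[ (EFin \o mom q) by apply: sub; rewrite // bnd_simp ltW.
have i2o : mu.-integrable `[U, V[ (EFin \o (fun u => osc u * mom q u)).
  by apply: sub; rewrite // bnd_simp ltW.
have mid : 2^-1 * \int[mu]_(u in `[U, V[) mom q u <=
    s * \int[mu]_(u in `[U, V[) (osc u * mom q u).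
  rewrite -!RintegralZl//; apply: le_Rintegral => //.
  - exact: (integrableZl _ 2^-1 i2).
  - exact: (integrableZl _ s i2o).
  move=> u; rewrite /= in_itv/= => /andP[Uu uV].
  have u0 : 0 < u by exact: lt_le_trans Uu.
  have u1 : 1 < u.
    apply: lt_le_trans Uu; rewrite -expR0 ltr_expR exprn_gt0//; lra.
  rewrite mulrA ler_wpM2r ?mom_ge0 ?(ltW u0)//.
  apply: osc_ge => //; rewrite -/K.
  set x := Num.sqrt _.
  have x0 : 0 <= x by exact: sqrtr_ge0.
  have x2 : x ^+ 2 = ln u by rewrite sqr_sqrtr// ln_ge0// ltW.
  have h1 : (2 * (K - 1) / 3) ^+ 2 <= x ^+ 2.
    by rewrite x2 -ler_expR lnK.
  have h2 : x ^+ 2 <= (2 * (K + 1) / 3) ^+ 2.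
    by rewrite x2 -ler_expR lnK// ltW.
  rewrite ler_sqr ?nnegrE// in h1; last by lra.
  rewrite ler_sqr ?nnegrE// in h2; last by lra.
  rewrite ler_norml; apply/andP; split; lra.
rewrite -/s (split3 _ io) !mulrDr.
have lower (y z : R) : `|y| <= z -> - z <= s * y.
  move=> yz; have : `|s * y| <= z by rewrite normrM s1 mul1r.
  by rewrite ler_norml => /andP[].
have n1 : - (\int[mu]_(u in `[0, U[) mom q u) <=
    s * \int[mu]_(u in `[0, U[) (osc u * mom q u).
  apply: lower; apply: outer => // u; rewrite /= !in_itv/= andbT.
  by case/andP.
have n2 : - (\int[mu]_(u in `[V, +oo[) mom q u) <=
    s * \int[mu]_(u in `[V, +oo[) (osc u * mom q u).
  apply: lower; apply: outer => // u; rewrite /= !in_itv/= !andbT.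
  by move=> Vu; rewrite (le_trans _ Vu)// ltW.
exact: (mass_comparison (split3 _ im) mid o1 o2 Mlow n1 n2).
Qed.
End eigenvalues.

(** * Orthogonality in the Fock space *)

Section orthogonality.
Variable R : realType.
Notation mu := (@lebesgue_measure R).
Implicit Types (m : nat).

Definition sector_sum (F : R * R -> R) (p : R * R) : R :=
  sector_weight p.1 p.2 * rot_sum F (ray p.1 p.2).

Lemma measurable_sector_sum (F : R * R -> R) : measurable_fun [set: R * R] F ->
  measurable_fun [set: R * R] (sector_sum F).
Proof.
move=> mF; apply: measurable_funM; first exact: measurable_weight.
have mr := @measurable_ray R.
have mro : measurable_fun [set: R * R] (fun p => rotp (ray p.1 p.2)).
  by apply: measurableT_comp => //; exact: measurable_rotp.
by apply: measurable_funD; apply: measurable_funD;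
  apply: measurableT_comp => //; apply: (measurableT_comp (@measurableNp R)).
Qed.

Lemma polar_integral_ge0 (F : R * R -> R) : measurable_fun [set: R * R] F ->
  (forall p, 0 <= F p) ->
  (\int[lebC R]_p (F p)%:E = \int[lebC R]_p (sector_sum F p)%:E)%E.
Proof.
move=> mF F0; rewrite polar_integral//; last by apply/measurable_EFinP.
Qed.

Lemma sector_sum_ge0 (F : R * R -> R) : (forall p, 0 <= F p) ->
  forall p, 0 <= sector_sum F p.
Proof.
by move=> F0 p; rewrite mulr_ge0 ?sector_weight_ge0// !addr_ge0.
Qed.

(** [sector_sum] is linear, so the nonnegative formula applies to the positive and negative
    parts. *)
Lemma polar_integral_signed (F : R * R -> R) :
  (lebC R).-integrable [set: R * R] (EFin \o F) ->
  (lebC R).-integrable [set: R * R] (EFin \o sector_sum F) /\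
  (\int[lebC R]_p (F p)%:E = \int[lebC R]_p (sector_sum F p)%:E)%E.
Proof.
move=> iF.
have mF : measurable_fun [set: R * R] F.
  by apply/measurable_EFinP; exact: measurable_int iF.
pose Fp p := Num.max (F p) 0; pose Fm p := Num.max (- F p) 0.
have mFp : measurable_fun [set: R * R] Fp by exact: measurable_maxr.
have mFm : measurable_fun [set: R * R] Fm.
  by apply: measurable_maxr => //; exact: measurableT_comp.
have Fp0 p : 0 <= Fp p by rewrite le_max lexx orbT.
have Fm0 p : 0 <= Fm p by rewrite le_max lexx orbT.
have FE p : F p = Fp p - Fm p.
  rewrite /Fp /Fm; case: (lerP 0 (F p)) => h.
    by rewrite max_r ?subr0// oppr_le0.
  by rewrite max_l ?sub0r ?opprK// oppr_ge0 ltW.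
have Fabs p : `|Fp p| <= `|F p| /\ `|Fm p| <= `|F p|.
  rewrite (ger0_norm (Fp0 p)) (ger0_norm (Fm0 p)) /Fp /Fm !ge_max !normr_ge0.
  by rewrite !andbT ler_norm -normrN ler_norm.
have iFp : (lebC R).-integrable [set: R * R] (EFin \o Fp).
  apply: le_integrable iF => //; first exact/measurable_EFinP.
  by move=> p _; rewrite /= lee_fin; have [] := Fabs p.
have iFm : (lebC R).-integrable [set: R * R] (EFin \o Fm).
  apply: le_integrable iF => //; first exact/measurable_EFinP.
  by move=> p _; rewrite /= lee_fin; have [] := Fabs p.
have iS (G : R * R -> R) : measurable_fun [set: R * R] G -> (forall p, 0 <= G p) ->
    (lebC R).-integrable [set: R * R] (EFin \o G) ->
    (lebC R).-integrable [set: R * R] (EFin \o sector_sum G).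
  move=> mG G0 /integrableP[_ fG]; apply/integrableP; split.
    by apply/measurable_EFinP; exact: measurable_sector_sum.
  under eq_integral => p _.
    rewrite /= ger0_norm ?sector_sum_ge0//; over.
  rewrite -polar_integral_ge0//.
  under eq_integral => p _ do rewrite -[G p]ger0_norm//.
  exact: fG.
have SE : sector_sum F = (fun p => sector_sum Fp p - sector_sum Fm p).
  by apply/funext => p; rewrite /sector_sum /rot_sum !FE; ring.
split.
  rewrite SE.
  exact: (integrableB _ (iS _ mFp Fp0 iFp) (iS _ mFm Fm0 iFm)).
transitivity (\int[lebC R]_p ((Fp p)%:E - (Fm p)%:E))%E.
  by apply: eq_integral => p _; rewrite FE EFinB.
transitivity (\int[lebC R]_p ((sector_sum Fp p)%:E - (sector_sum Fm p)%:E))%E.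
  refine (eq_trans (integralB measurableT iFp iFm) _).
  refine (eq_trans _ (esym (integralB measurableT
    (iS _ mFp Fp0 iFp) (iS _ mFm Fm0 iFm)))).
  by congr (_ - _)%E; exact: polar_integral_ge0.
by apply: eq_integral => p _; rewrite SE EFinB.
Qed.

End orthogonality.

(** * Planar integrals containing a radial factor *)

Section radial.
Variable R : realType.
Notation mu := (@lebesgue_measure R).
Implicit Types (m : nat).

Lemma measurable_cabs : measurable_fun [set: R * R] (fun p => cabs (toC p)).
Proof.
apply: measurableT_comp.
  by apply: continuous_measurable_fun; exact: sqrt_continuous.
by apply: measurable_funD; exact: measurable_funX.
Qed.

Lemma integral_ind (D : set R) (P : R -> bool) (h : R -> R) :
  (forall u, (u \in D) = P u) ->
  (\int[mu]_u (ind R (P u) * h u)%:E = \int[mu]_(u in D) (h u)%:E)%E.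
Proof.
move=> DP; rewrite [RHS]integral_mkcond; apply: eq_integral => u _.
by rewrite patchE DP /ind; case: ifP; rewrite ?mul1r ?mul0r.
Qed.

Lemma integral_ind_pos (h : R -> R) : h 0 = 0 ->
  (\int[mu]_u (ind R (0 < u)%R * h u)%:E = \int[mu]_(u in `[0%R, +oo[) (h u)%:E)%E.
Proof.
move=> h0; rewrite [RHS]integral_mkcond; apply: eq_integral => u _.
rewrite patchE mem_setE in_itv/= andbT /ind.
by case: ltrgtP => [_|_|<-]; rewrite ?mul1r ?mul0r ?h0.
Qed.

Lemma integral_ind_itv (h : R -> R) :
  (\int[mu]_t (ind R (`|t| <= 1)%R * h t)%:E =
   \int[mu]_(t in `[(-1)%R, 1%R]) (h t)%:E)%E.
Proof.
by apply: integral_ind => u; rewrite mem_setE in_itv/= ler_norml.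
Qed.

(** Only finiteness is wanted, so 1 / (1 + t^2) is bounded by 1, and the constant 2 pi is replaced
    by 4 * 2 = 8. *)
Lemma radial_integral_lty (b : R -> R) : measurable_fun [set: R] b ->
  (forall r, 0 <= b r) ->
  (\int[mu]_(r in `[0%R, +oo[) (r * b r)%:E < +oo)%E ->
  (\int[lebC R]_p (b (cabs (toC p)))%:E < +oo)%E.
Proof.
move=> mb b0 bfin.
have mbC : measurable_fun [set: R * R] (fun p => b (cabs (toC p))).
  exact: (measurableT_comp mb measurable_cabs).
rewrite polar_integral_ge0//.
pose h (p : R * R) : R := ind R (`|p.2| <= 1) * (4 * (ind R (0 < p.1) * (p.1 * b p.1))).
have mh : measurable_fun [set: R * R] h.
  apply: measurable_funM.
    apply: measurable_ind; apply: measurable_fun_ler => //.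
    exact: measurableT_comp.
  apply: measurable_funM => //; apply: measurable_funM.
    by apply: measurable_ind; exact: measurable_fun_ltr.
  by apply: measurable_funM => //; exact: measurableT_comp.
have k0 r : 0 <= ind R (0 < r) * (r * b r).
  by rewrite /ind; case: ltrP => r0; rewrite ?mul0r// mul1r mulr_ge0// ltW.
have h0 p : 0 <= h p by rewrite mulr_ge0 ?ind_ge0// mulr_ge0.
apply: (@le_lt_trans _ _ (\int[lebC R]_p (h p)%:E)%E).
  apply: ge0_le_integral => //.
  - by move=> p _; rewrite lee_fin sector_sum_ge0.
  - by apply/measurable_EFinP; exact: (measurable_sector_sum mbC).
  - exact/measurable_EFinP.
  - move=> [r t] _; rewrite lee_fin /sector_sum /sector_weight /h /=.
    rewrite -mulrA ler_wpM2l ?ind_ge0// /ind; case: ltrP => r0; last first.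
      by rewrite !mul0r mulr0.
    have -> : rot_sum (fun p : R * R => b (cabs (toC p))) (ray r t) = 4 * b r.
      rewrite /rot_sum !toCN toC_rotp !cabsN cabsM cabs_im mul1r cabs_ray//.
      by ring.
    rewrite !mul1r (mulrCA 4) ler_wpM2r ?mulr_ge0//.
    rewrite ler_pdivrMr ?ltr_pwDl ?sqr_ge0// ler_peMr ?(ltW r0)//.
    by rewrite lerDl sqr_ge0.
rewrite (@fubini_tonelli2 _ _ _ _ R mu mu (EFin \o h)); last 2 first.
- exact/measurable_EFinP.
- by move=> p; rewrite lee_fin.
rewrite /fubini_G /=.
have E t : (\int[mu]_r (h (r, t))%:E =
    (ind R (`|t| <= 1)%R * 4)%:E * \int[mu]_(r in `[0%R, +oo[) (r * b r)%:E)%E.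
  rewrite -(@integral_ind_pos (fun r => r * b r)) ?mul0r//.
  rewrite -ge0_integralZl//.
  - by apply: eq_integral => r _; rewrite -EFinM /h mulrA.
  - apply/measurable_EFinP; apply: measurable_funM.
      by apply: measurable_ind; exact: measurable_fun_ltr.
    exact: measurable_funM.
  - by move=> r _; rewrite lee_fin.
  - by rewrite lee_fin mulr_ge0 ?ind_ge0.
under eq_integral do rewrite E.
have fin : (\int[mu]_(r in `[0%R, +oo[) (r * b r)%:E \is a fin_num)%E.
  rewrite ge0_fin_numE//; apply: integral_ge0 => r; rewrite /= in_itv/= andbT.
  by move=> r0; rewrite lee_fin mulr_ge0.
rewrite -(fineK fin); set H := fine _.
under eq_integral do rewrite -EFinM -mulrA.
rewrite (integral_ind_itv (fun=> 4 * H)) integral_cst//.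
have mu2 : mu (`[-1, 1]%classic : set R) = 2%:E.
  rewrite lebesgue_measure_itv/= lte_fin gtrN// -EFinB opprK.
  by congr EFin; ring.
by rewrite [X in (_ * X)%E]mu2 -EFinM ltry.
Qed.

(** Integrating over t first, [sector_mean] gives C r^(2m) and the polar density one more r; what
    remains is C times the vanishing moment of [psi]. Integrability on the plane justifies
    Fubini. *)
Lemma radial_orthogonality (psi : R -> R) (k : R[i] -> R[i]) m : entire k ->
  (lebC R).-integrable [set: R * R] (EFin \o (fun p =>
     psi (cabs (toC p)) * complex.Re (toC p ^+ m * conjc (k (toC p))))) ->
  mu.-integrable `[0%R, +oo[ (EFin \o (fun r => psi r * r ^+ (2 * m + 1))) ->
  \int[mu]_(r in `[0, +oo[) (psi r * r ^+ (2 * m + 1)) = 0 ->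
  (\int[lebC R]_p (psi (cabs (toC p)) *
    complex.Re (toC p ^+ m * conjc (k (toC p))))%:E = 0)%E.
Proof.
move=> ek iF ipsi psi0; have [C HC] := sector_mean m ek.
set F : R * R -> R := fun p => _ in iF *.
have [iS ->] := polar_integral_signed iF.
rewrite -(@integral12_prod_meas1 _ _ _ _ R mu mu _ iS) /fubini_F /=.
have E r : (\int[mu]_t (sector_sum F (r, t))%:E =
    (ind R (0 < r)%R * (C * (psi r * r ^+ (2 * m + 1))))%:E)%E.
  have [r0|r0] := ltrP 0 r; last first.
    rewrite {1}/ind mul0r; apply: integral0_eq => t _.
    by rewrite /sector_sum /sector_weight /ind /= ltNge r0 /= mul0r mulr0 mul0r.
  have [ig gE] := HC _ r0.
  transitivity (\int[mu]_(t in `[(-1)%R, 1%R]) ((r * psi r) * arc_density k m r t)%:E)%E.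
    rewrite -integral_ind_itv; apply: eq_integral => t _; congr EFin.
    have -> : sector_sum F (r, t) =
      sector_weight r t * rot_sum F (ray r t) by [].
    have -> : rot_sum F (ray r t) =
        psi r * (arc_density k m r t * (1 + t ^+ 2)).
      rewrite /arc_density divfK; last by rewrite gt_eqF// ltr_pwDl// sqr_ge0.
      rewrite /rot_sum /F !toCN toC_rotp !cabsN cabsM cabs_im mul1r cabs_ray//.
      by rewrite !mulrDr.
    rewrite /sector_weight r0 (_ : ind R true = 1)//; field.
    by rewrite gt_eqF// ltr_pwDl// sqr_ge0.
  under eq_integral do rewrite EFinM.
  rewrite integralZl// gE -EFinM /ind mul1r; congr EFin.
  by rewrite exprD expr1; ring.
under eq_integral do rewrite E.
rewrite (integral_ind_pos (h := fun r => C * (psi r * r ^+ (2 * m + 1)))); last first.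
  by rewrite addn1 expr0n !mulr0.
under eq_integral do rewrite EFinM.
rewrite integralZl// -[X in (_ * X)%E]fineK; last exact: integrable_fin_num.
by rewrite [fine _]psi0 mule0.
Qed.

End radial.

(** * Square-integrable functions, monomials and the orthogonality relation *)

Section toeplitz.
Variable R : realType.
Notation mu := (@lebesgue_measure R).
Notation wgt := (@log_weight R).
Implicit Types (m : nat) (f g k : R[i] -> R[i]).

Lemma Re_mulc (x y : R[i]) : complex.Re (x * y) =
  complex.Re x * complex.Re y - complex.Im x * complex.Im y.
Proof. by case: x y => [a b] [c d]. Qed.

Lemma Im_mulc (x y : R[i]) : complex.Im (x * y) =
  complex.Re x * complex.Im y + complex.Im x * complex.Re y.
Proof. by case: x y => [a b] [c d]. Qed.

Lemma CmeasurableM f g : Cmeasurable f -> Cmeasurable g ->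
  Cmeasurable (fun z => f z * g z).
Proof.
move=> [rf jf] [rg jg]; split.
- rewrite (_ : (fun p => _) = (fun p => complex.Re (f (toC p)) * complex.Re (g (toC p)) -
    complex.Im (f (toC p)) * complex.Im (g (toC p)))); last first.
    by apply/funext => p; rewrite Re_mulc.
  by apply: measurable_funB; exact: measurable_funM.
- rewrite (_ : (fun p => _) = (fun p => complex.Re (f (toC p)) * complex.Im (g (toC p)) +
    complex.Im (f (toC p)) * complex.Re (g (toC p)))); last first.
    by apply/funext => p; rewrite Im_mulc.
  by apply: measurable_funD; exact: measurable_funM.
Qed.

Lemma Cmeasurable_cst (c : R[i]) : Cmeasurable (fun=> c).
Proof. by split; exact: measurable_cst. Qed.

Lemma Cmeasurable_conjc f : Cmeasurable f -> Cmeasurable (fun z => conjc (f z)).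
Proof.
move=> [rf jf]; split.
- rewrite (_ : (fun p => _) = (fun p => complex.Re (f (toC p))))//.
  by apply/funext => p; case: (f (toC p)).
- rewrite (_ : (fun p => _) = (fun p => - complex.Im (f (toC p)))).
    exact: measurableT_comp.
  by apply/funext => p; case: (f (toC p)).
Qed.

Lemma cabs_conjc (z : R[i]) : cabs (conjc z) = cabs z.
Proof. by case: z => a b; rewrite /cabs /= sqrrN. Qed.

Lemma Cmeasurable_monomial (c : R[i]) m : Cmeasurable (fun z => c * z ^+ m).
Proof.
elim: m => [|m IH].
  rewrite (_ : (fun z => _) = (fun=> c)); first exact: Cmeasurable_cst.
  by apply/funext => z; rewrite expr0 mulr1.
rewrite (_ : (fun z => _) = (fun z => c * z ^+ m * z)).
  by apply: CmeasurableM => //; split => /=; [exact: measurable_fst|exact: measurable_snd].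
by apply/funext => z; rewrite exprSr mulrA.
Qed.

Lemma Cmeasurable_cabs f : Cmeasurable f ->
  measurable_fun [set: R * R] (fun p => cabs (f (toC p))).
Proof.
move=> [rf jf].
rewrite (_ : (fun p => _) = (fun p => Num.sqrt (complex.Re (f (toC p)) ^+ 2 +
  complex.Im (f (toC p)) ^+ 2))); last first.
  by apply/funext => p; case: (f (toC p)).
apply: measurableT_comp.
  by apply: continuous_measurable_fun; exact: sqrt_continuous.
by apply: measurable_funD; exact: measurable_funX.
Qed.

Lemma entire_monomial (c : R[i]) m : entire (fun z => c * z ^+ m).
Proof.
move=> z; apply: derivableM; first exact: derivable_cst.
have d : derivable (id : Cfield R -> Cfield R) z 1 by exact: derivable_id.
by have := @derivableX _ _ _ m _ _ d; rewrite exprfctE.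
Qed.

Lemma entireZ (c : R[i]) k : entire k -> entire (fun z => c * k z).
Proof. by move=> ek z; apply: derivableM; [exact: derivable_cst|exact: ek]. Qed.

Lemma measurable_L2_density f : Cmeasurable f ->
  measurable_fun [set: R * R]
    (fun p => cabs (f (toC p)) ^+ 2 * wt (cabs (toC p))).
Proof.
move=> mf; apply: measurable_funM.
  by apply: measurable_funX; exact: Cmeasurable_cabs.
exact: (measurableT_comp (@measurable_wt R) (@measurable_cabs R)).
Qed.

Lemma L2_densityE f : (fun p => (cabs (f (toC p)) ^+ 2 *
    expR (- (2 * wgt (cabs (toC p)))))%:E) =
  EFin \o (fun p => cabs (f (toC p)) ^+ 2 * wt (cabs (toC p))).
Proof. by apply/funext => p /=; rewrite log_weightE. Qed.

Lemma L2_integrable f : L2 wgt f -> (lebC R).-integrable [set: R * R]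
  (EFin \o (fun p => cabs (f (toC p)) ^+ 2 * wt (cabs (toC p)))).
Proof.
move=> [mf fin]; apply/integrableP; split.
  by apply/measurable_EFinP; exact: measurable_L2_density.
rewrite L2_densityE in fin; apply: le_lt_trans fin.
rewrite le_eqVlt; apply/orP; left; apply/eqP; apply: eq_integral => p _ /=.
by rewrite ger0_norm// mulr_ge0 ?sqr_ge0 ?wt_ge0.
Qed.

Lemma L2_monomial (c : R[i]) m : L2 wgt (fun z => c * z ^+ m).
Proof.
split; first exact: Cmeasurable_monomial.
rewrite (L2_densityE (fun z => c * z ^+ m)).
rewrite (_ : EFin \o _ = (fun p => ((fun r => cabs c ^+ 2 * (r ^+ (2 * m) * wt r))
   (cabs (toC p)))%:E)); last first.
  apply/funext => p /=; congr EFin.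
  by rewrite cabsM cabsX exprMn -exprM (mulnC m) mulrA.
apply: (@radial_integral_lty R (fun r => cabs c ^+ 2 * (r ^+ (2 * m) * wt r))).
- apply: measurable_funM => //; apply: measurable_funM => //.
  exact: measurable_wt.
- move=> r; rewrite mulr_ge0 ?sqr_ge0// mulr_ge0 ?wt_ge0//.
  by rewrite exprM exprn_ge0// sqr_ge0.
rewrite (_ : (fun r => _) = EFin \o (fun r => cabs c ^+ 2 * mom (2 * m + 1) r)).
  have ic : mu.-integrable `[0%R, +oo[
      (EFin \o (fun r => cabs c ^+ 2 * mom (2 * m + 1) r)).
    exact: (integrableZl _ (cabs c ^+ 2) (@integrable_mom R (2 * m + 1))).
  have : (\int[mu]_(r in `[0%R, +oo[) (cabs c ^+ 2 * mom (2 * m + 1) r)%:E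
    \is a fin_num)%E by exact: integrable_fin_num.
  by rewrite fin_numElt => /andP[].
by apply/funext => r /=; congr EFin; rewrite /mom exprD expr1; ring.
Qed.

Lemma L2_bounded_mul phi f : Cmeasurable phi -> (forall z, cabs (phi z) <= 1) ->
  L2 wgt f -> L2 wgt (fun z => phi z * f z).
Proof.
move=> mphi phi1 [mf fin]; split; first exact: CmeasurableM.
apply: le_lt_trans fin.
rewrite (L2_densityE f) (L2_densityE (fun z => phi z * f z)).
apply: ge0_le_integral => //.
- by move=> p _; rewrite lee_fin mulr_ge0 ?sqr_ge0 ?wt_ge0.
- by apply/measurable_EFinP; exact: (measurable_L2_density (CmeasurableM mphi mf)).
- by apply/measurable_EFinP; exact: (measurable_L2_density mf).
- move=> p _; rewrite lee_fin ler_wpM2r ?wt_ge0//.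
  rewrite ler_sqr ?nnegrE ?cabs_ge0// cabsM ler_piMl ?cabs_ge0//.
Qed.


Definition eigen m : R :=
  moment wgt (@osc R) m / moment wgt (fun=> 1) m.

Lemma moment1E m : moment wgt (fun=> 1 : R) m =
  \int[mu]_(u in `[0, +oo[) mom (2 * m + 1) u.
Proof. by rewrite momentE; apply: eq_Rintegral => u _; rewrite mul1r. Qed.

Lemma moment1_gt0 m : 0 < moment wgt (fun=> 1 : R) m.
Proof.
rewrite moment1E.
have m2 : 3 / 2 <= (2 * m + 1).+1%:R :> R.
  have : (2%:R : R) <= (2 * m + 1).+1%:R by rewrite ler_nat addn1.
  by lra.
have low := @mom_lower R (2 * m + 1) m2.
have : ((expR (4 / 27 * (2 * m + 1).+1%:R ^+ 3 - 1) / 2)%:E <=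
    (\int[mu]_(u in `[0, +oo[) mom (2 * m + 1) u)%:E :> \bar R)%E.
  by rewrite fineK//; apply: integrable_fin_num => //; exact: integrable_mom.
by rewrite lee_fin; apply: lt_le_trans; rewrite divr_gt0// expR_gt0.
Qed.

(** Symbol minus eigenvalue, with the factor e^(-2h) of the inner product included; [eigen m] is
    exactly the constant that kills its moment of order 2m + 1. *)
Definition osc_defect m (r : R) : R := (osc r - eigen m) * wt r.

Lemma measurable_osc_defect m : measurable_fun [set: R] (osc_defect m).
Proof.
apply: measurable_funM; last exact: measurable_wt.
by apply: measurable_funB => //; exact: measurable_osc.
Qed.

Lemma osc_defect_moment m :
  mu.-integrable `[0%R, +oo[ (EFin \o (fun r => osc_defect m r * r ^+ (2 * m + 1))) /\
  \int[mu]_(r in `[0, +oo[) (osc_defect m r * r ^+ (2 * m + 1)) = 0.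
Proof.
have im := @integrable_mom R (2 * m + 1).
have io := integrable_bounded_mom (2 * m + 1) (@measurable_osc R) (@norm_osc R).
have il : mu.-integrable `[0%R, +oo[
    (EFin \o (fun r => eigen m * mom (2 * m + 1) r)).
  exact: (integrableZl _ (eigen m) im).
have E : (fun r => osc_defect m r * r ^+ (2 * m + 1)) =
    (fun r => osc r * mom (2 * m + 1) r - eigen m * mom (2 * m + 1) r).
  by apply/funext => r; rewrite /osc_defect /mom; ring.
rewrite E; split; first exact: (integrableB _ io il).
rewrite RintegralB// RintegralZl// -momentE -moment1E /eigen.
by rewrite divfK ?subrr// gt_eqF// moment1_gt0.
Qed.

Lemma norm_osc_defect m r : `|osc_defect m r| <= (1 + `|eigen m|) * wt r.
Proof.
rewrite /osc_defect normrM (ger0_norm (wt_ge0 r)) ler_wpM2r ?wt_ge0//.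
by rewrite (le_trans (ler_normB _ _))// lerD2r norm_osc.
Qed.

(** The free constant c absorbs the coefficient of the monomial and, when multiplied by a power of
    i, turns this statement on real parts into one on imaginary parts. *)
Lemma osc_defect_orthogonal (c : R[i]) k m : fock wgt k ->
  (\int[lebC R]_p (osc_defect m (cabs (toC p)) *
    complex.Re (toC p ^+ m * conjc (c * k (toC p))))%:E = 0)%E.
Proof.
move=> [ek Lk]; have [ipsi psi0] := osc_defect_moment m.
apply: (radial_orthogonality (k := fun z => c * k z) _ _ ipsi psi0).
  exact: entireZ.
(* Domination by a b <= a^2 + b^2 with a = |z^m| and b = |k z|, whose weighted squares are both
   integrable. *)
pose B := (1 + `|eigen m|) * cabs c.
have B0 : 0 <= B by rewrite mulr_ge0 ?cabs_ge0// addr_ge0.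
have i1 := L2_integrable (L2_monomial 1 m).
have i2 := L2_integrable Lk.
have iB := integrableZl measurableT B (integrableD measurableT i1 i2).
apply: le_integrable iB => //.
- apply/measurable_EFinP; apply: measurable_funM.
    exact: (measurableT_comp (@measurable_osc_defect m) (@measurable_cabs R)).
  have mck : Cmeasurable (fun z => c * k z).
    by apply: CmeasurableM; [exact: Cmeasurable_cst|case: Lk].
  have mz : Cmeasurable (fun z : R[i] => z ^+ m).
    rewrite (_ : (fun z => _) = (fun z => 1 * z ^+ m)).
      exact: Cmeasurable_monomial.
    by apply/funext => z; rewrite mul1r.
  by have [] := CmeasurableM mz (Cmeasurable_conjc mck).
move=> p _; set z := toC p.
rewrite -[X in (_ <= X)%E]/(`|B * (cabs (1 * z ^+ m) ^+ 2 * wt (cabs z) +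
  cabs (k z) ^+ 2 * wt (cabs z))|%:E).
rewrite -[X in (X <= _)%E]/(`|osc_defect m (cabs z) *
  complex.Re (z ^+ m * conjc (c * k z))|%:E) -mulrDl.
rewrite mul1r lee_fin normrM [leRHS]ger0_norm; last first.
  by rewrite mulr_ge0// mulr_ge0 ?wt_ge0// addr_ge0// sqr_ge0.
have h1 := norm_osc_defect m (cabs z).
have h2 : `|complex.Re (z ^+ m * conjc (c * k z))| <=
    cabs c * (cabs (z ^+ m) * cabs (k z)).
  by rewrite (le_trans (Re_le_cabs _))// cabsM cabs_conjc cabsM mulrCA.
apply: (le_trans (ler_pM _ _ h1 h2)) => //.
rewrite /B -!mulrA ler_wpM2l ?addr_ge0// (mulrC (wt _)) -!mulrA.
rewrite ler_wpM2l ?cabs_ge0// mulrA ler_wpM2r ?wt_ge0//.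
set a := cabs _; set b := cabs _.
have : 0 <= a by exact: cabs_ge0.
have : 0 <= b by exact: cabs_ge0.
by clearbody a b; nra.
Qed.

End toeplitz.

(** * The symbol, its Toeplitz action on monomials, and the failure of uniform continuity *)

Section symbol.
Variable R : realType.
Notation mu := (@lebesgue_measure R).
Notation wgt := (@log_weight R).

Definition osc_radial (u : R) : R[i] := Complex (osc u) 0.
Definition osc_symbol (z : R[i]) : R[i] := osc_radial (cabs z).
Notation lambda := (eigenvalue_seq wgt osc_radial).

Lemma lambdaE m : lambda m = Complex (eigen R m) 0.
Proof.
rewrite /eigenvalue_seq; congr Complex.
rewrite (_ : moment _ _ m = 0) ?mul0r// momentE.
rewrite -[RHS](@Rintegral_set0 _ _ _ mu (fun=> 0)).
rewrite /Rintegral integral_set0 integral0_eq// => u _.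
by rewrite mul0r.
Qed.

Lemma cabs_osc_symbol z : cabs (osc_symbol z) <= 1.
Proof.
rewrite /cabs /= expr0n /= addr0 sqrtr_sqr; exact: norm_osc.
Qed.

Lemma Cmeasurable_osc_symbol : Cmeasurable osc_symbol.
Proof.
split; last exact: measurable_cst.
exact: (measurableT_comp (@measurable_osc R) (@measurable_cabs R)).
Qed.

Lemma conjcM (x y : R[i]) : conjc (x * y) = conjc x * conjc y.
Proof. exact: rmorphM. Qed.

Lemma inner_osc_defect (c : R[i]) m k : fock wgt k ->
  inner wgt (fun z => osc_symbol z * (c * z ^+ m) - lambda m * (c * z ^+ m)) k
  = 0.
Proof.
move=> Fk; rewrite /inner lambdaE.
have H (d : R[i]) := osc_defect_orthogonal (conjc d) m Fk.
have E (z : R[i]) : (osc_symbol z * (c * z ^+ m) - Complex (eigen R m) 0 * (c * z ^+ m)) *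
    conjc (k z) * Complex (expR (- (2 * wgt (cabs z)))) 0 =
    Complex (osc_defect m (cabs z)) 0 * (z ^+ m * conjc (conjc c * k z)).
  rewrite log_weightE.
  have -> : Complex (osc_defect m (cabs z)) 0 =
     (osc_symbol z - Complex (eigen R m) 0) * Complex (wt (cabs z)) 0.
    apply/eqP; rewrite eq_complex /= /osc_defect.
    by apply/andP; split; apply/eqP; ring.
  by rewrite conjcM conjcK; ring.
have ReR (a : R) (x : R[i]) : complex.Re (Complex a 0 * x) = a * complex.Re x.
  by rewrite Re_mulc /= mul0r subr0.
(* Im x = Re (- i x): the imaginary part of the inner product is the real-part case for another
   constant. *)
have ImR (a : R) (x : R[i]) : complex.Im (Complex a 0 * x) =
    a * complex.Re (Complex 0 (-1) * x).
  by case: x => u v /=; ring.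
rewrite /Cintegral; congr Complex; rewrite /Rintegral.
- rewrite (eq_integral (fun p => (osc_defect m (cabs (toC p)) *
    complex.Re (toC p ^+ m * conjc (conjc c * k (toC p))))%:E)) ?H//.
  by move=> p _; rewrite E ReR.
- rewrite (eq_integral (fun p => (osc_defect m (cabs (toC p)) *
    complex.Re (toC p ^+ m * conjc (conjc (Complex 0 (-1) * c) * k (toC p))))%:E)) ?H//.
  move=> p _; rewrite E ImR !conjcM !conjcK.
  congr (_ * complex.Re _)%:E; ring.
Qed.

Lemma osc_toeplitz m (c : R[i]) : is_toeplitz wgt osc_symbol
  (fun z => c * z ^+ m) (fun z => lambda m * (c * z ^+ m)).
Proof.
have Fm (d : R[i]) : fock wgt (fun z => d * z ^+ m).
  by split; [exact: entire_monomial|exact: L2_monomial].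
split; first exact: Fm.
split.
- apply: L2_bounded_mul; [exact: Cmeasurable_osc_symbol|exact: cabs_osc_symbol|].
  exact: L2_monomial.
- rewrite (_ : (fun z => _) = (fun z => (lambda m * c) * z ^+ m)); first exact: Fm.
  by apply/funext => z; rewrite mulrA.
- by move=> k Fk; exact: inner_osc_defect.
Qed.

Lemma eigen_ge i m : (7 <= i)%N -> (2 * m + 1).+1 = (8 * i)%N ->
  4^-1 <= (-1) ^+ i * eigen R m.
Proof.
move=> i7 mi; have := @eigen_lower R i (2 * m + 1) i7 mi.
rewrite -moment1E -momentE => h.
by rewrite /eigen mulrA ler_pdivlMr// moment1_gt0.
Qed.

(** The square roots x of m and y of m + 4 satisfy (y - x) (y + x) = 4, and x > 4 / d. *)
Lemma rho_small (d : R) (m : nat) : 0 < d -> (4 / d) ^+ 2 < m%:R ->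
  rho R (m + 4) m < d.
Proof.
move=> d0 md; rewrite /rho.
set x := Num.sqrt (m%:R : R); set y := Num.sqrt _.
have x0 : 0 <= x by exact: sqrtr_ge0.
have y0 : 0 <= y by exact: sqrtr_ge0.
have x2 : x ^+ 2 = m%:R by rewrite sqr_sqrtr.
have y2 : y ^+ 2 = x ^+ 2 + 4 by rewrite x2 sqr_sqrtr// natrD.
have dx : 4 / d < x.
  by rewrite -ltr_sqr ?nnegrE ?x2// divr_ge0// ltW.
have {}dx : 4 < x * d by rewrite -ltr_pdivrMr.
have xy : x <= y by rewrite -ler_sqr ?nnegrE// y2 lerDl.
rewrite ger0_norm ?subr_ge0// ltNge; apply/negP => dyx.
have : (y - x) * (y + x) = 4 by ring: y2.
by nra.
Qed.

Lemma eigenvalues_not_unif_continuous : ~ rho_unif_continuous lambda.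
Proof.
move=> /(_ 2^-1); rewrite invr_gt0 ltr0n => /(_ isT)[d d0 H].
(* m + 1 = 4i gives exponent 2m + 1 = 8i - 1, and m + 4 belongs to i + 1. The summand 7 meets
   [eigen_ge]; the bound makes m exceed (4 / d)^2. *)
pose i := (Num.bound ((4 / d) ^+ 2) + 7)%N.
pose m := (4 * i).-1.
have i7 : (7 <= i)%N by rewrite leq_addl.
have mi : (2 * m + 1).+1 = (8 * i)%N.
  by rewrite /m; lia.
have mi' : (2 * (m + 4) + 1).+1 = (8 * i.+1)%N.
  by rewrite /m; lia.
have := H (m + 4)%N m; rewrite rho_small//; last first.
  apply: (@lt_le_trans _ _ (Num.bound ((4 / d) ^+ 2))%:R).
    by apply: archi_boundP; exact: sqr_ge0.
  by rewrite ler_nat /m /i; lia.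
move=> /(_ isT); rewrite !lambdaE => /(le_lt_trans (Re_le_cabs _)) /=.
have h1 := eigen_ge i7 mi; have h2 := eigen_ge (leqW i7) mi'.
rewrite exprS mulN1r mulNr in h2.
(* The two eigenvalues have opposite signs and absolute value at least 1/4, hence differ by at least
   1/2, the chosen epsilon. *)
have [s1|s1] : (-1) ^+ i = 1 :> R \/ (-1) ^+ i = -1 :> R.
  by rewrite -signr_odd; case: odd; [right|left].
all: rewrite s1 in h1 h2; rewrite ltr_norml => /andP[]; lra.
Qed.

End symbol.

Theorem theorem9p1 (R : realType) :
  exists (phi : R[i] -> R[i]) (a : R -> R[i]),
    let lambda := eigenvalue_seq (@log_weight R) a in
    [/\ Linfty phi,
        is_radial phi a,
        (* T_phi acts on the line spanned by z^m as the scalar lambda_m *)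
        forall (m : nat) (c : R[i]),
          is_toeplitz (@log_weight R) phi
            (fun z => c * z ^+ m) (fun z => lambda m * (c * z ^+ m)) &
        ~ rho_unif_continuous lambda].
Proof.
exists (@osc_symbol R), (@osc_radial R); split.
- split; first exact: Cmeasurable_osc_symbol.
  by exists 1; apply: aeW => p; exact: cabs_osc_symbol.
- split; last by apply: aeW.
    by apply: measurable_funTS; exact: measurable_osc.
  exact: measurable_cst.
- exact: osc_toeplitz.
- exact: eigenvalues_not_unif_continuous.
Qed.
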